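(* Let $0<p\le\frac34$ and $q\in(0,1)$, and let $(S_n)_{n\ge0}$ be the elephant random walk with parameters $p,q$ and law $\mathbb{P}$. Define $$h(0,0):=a_1,\qquad h(m,y):=a_m|y|\quad\text{for integers } m>0,\ y\neq0 .$$ Then for every integer $m\ge0$ and every $A\in\sigma(S_0,\dots,S_m)$, $$\lim_{N\to\infty}\mathbb{P}(A\mid T_0>N)=\mathbb{P}\left[1_A\cdot\frac{h(m,S_m)}{h(0,0)}\,1_{\{T_0>m\}}\right].$$ Moreover, $h$ is a space-time harmonic function for the elephant random walk killed upon hitting $0$, that is, $$\mathbb{P}_{(m,y)}\big[h(m+1,S_{m+1}),\ S_{m+1}\neq0\big]=h(m,y)$$ for $(m,y)=(0,0)$, and for all integers $m\ge1$ and $y\ne0$.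
   Context: Elephant random walk (ERW): $S_0=0$, $S_n=X_1+\cdots+X_n$ for $n\ge1$, where $X_1=+1$ with probability $q$ and $X_1=-1$ with probability $1-q$, and for $n\ge 1$, $X_{n+1}=+X_{U_n}$ with probability $p$ and $X_{n+1}=-X_{U_n}$ with probability $1-p$, with $U_n$ uniform on $\{1,\dots,n\}$; all random choices are mutually independent. $(S_n)$ is a time-inhomogeneous Markov chain with $\mathbb{P}(S_{n+1}=x\pm1\mid S_n=x)=\frac12\pm(p-\frac12)\frac{x}{n}$ for $n\ge1$. $\mathbb{P}[\cdot]$ denotes expectation under $\mathbb{P}$, and $\mathbb{P}[X,\,E]:=\mathbb{P}[X1_E]$. $T_0:=\inf\{n\ge1: S_n=0\}$. $a_n:=\dfrac{\Gamma(n)}{\Gamma(n+2p-1)}$ for $n\ge1$. The value of $h(m,S_m)1_{\{T_0>m\}}$ is $0$ on $\{T_0\le m\}$. $\mathbb{P}_{(m,y)}$ is the law of the ERW started from $y$ at time $m$ (so $\mathbb{P}_{(0,0)}=\mathbb{P}$). The one-step expectation is computed with the transition probabilities: for $m\ge1$, $\mathbb{P}_{(m,y)}[f(S_{m+1})]=f(y+1)\left(\frac12+(p-\frac12)\frac ym\right)+f(y-1)\left(\frac12-(p-\frac12)\frac ym\right)$, and $\mathbb{P}_{(0,0)}[f(S_1)]=q f(1)+(1-q)f(-1)$. *)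

(* Defs.v *)
From HB Require Import structures.
From mathcomp Require Import all_boot all_order all_algebra finmap.
From mathcomp Require Import all_classical all_reals all_analysis.

Set Implicit Arguments.
Unset Strict Implicit.
Unset Printing Implicit Defensive.

Import Order.TTheory GRing.Theory Num.Theory.
Import numFieldNormedType.Exports.

Local Open Scope classical_set_scope.
Local Open Scope ring_scope.

HB.instance Definition _ := isPointed.Build int 0.
HB.instance Definition _ := @isMeasurable.Build default_measure_display
  int (@discrete_measurable int) (@discrete_measurable0 int)
  (@discrete_measurableC int) (@discrete_measurableU int).

(* Euler's Gamma function; the integral converges exactly for x > 0, the only
   arguments at which it is used below (n >= 1 and p > 0 give
   n + 2p - 1 > 0). *)
Definition Gamma (R : realType) (x : R) : R :=
  \int[@lebesgue_measure R]_(t in `]0, +oo[) (t `^ (x - 1) * expR (- t)).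

Section probability.
Context d (T : measurableType d) (R : realType) (P : probability T R).

Definition cond_prob (A E : set T) : R := fine (P (A `&` E)) / fine (P E).

Definition mutually_independent (I : choiceType) (F : I -> set (set T)) :=
  forall (J : {fset I}) (E : I -> set T),
    (forall i, i \in J -> F i (E i)) ->
    P (\bigcap_(i in [set` J]) E i) = (\prod_(i <- J) P (E i))%E.

End probability.

Section elephant_random_walk.
Context d (T : measurableType d) (R : realType) (P : probability T R).
Implicit Types (X eps : nat -> {RV P >-> int}) (U : nat -> {RV P >-> nat}).

(* The sigma-algebras generated by the random choices X_1, U_n and eps_n
   (n >= 1), where eps_n is the sign with which the step X_(U_n) is
   repeated. *)
Definition erw_choice X U eps (i : option (nat + nat)) : set (set T) :=
  match i with
  | None => g_sigma_algebra_preimage (X 1%N)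
  | Some (inl n) => g_sigma_algebra_preimage (U n.+1)
  | Some (inr n) => g_sigma_algebra_preimage (eps n.+1)
  end.

(* X 0, U 0 and eps 0 are irrelevant. *)
Record elephant_random_walk (p q : R) X U eps : Prop := {
  erw_first_pos : P (X 1%N @^-1` [set 1]) = q%:E ;
  erw_first_neg : P (X 1%N @^-1` [set -1]) = (1 - q)%:E ;
  erw_memory : forall n k : nat, (1 <= k <= n)%N ->
    P (U n @^-1` [set k]) = (n%:R^-1)%:E ;
  erw_sign_pos : forall n, (1 <= n)%N -> P (eps n @^-1` [set 1]) = p%:E ;
  erw_sign_neg : forall n, (1 <= n)%N ->
    P (eps n @^-1` [set -1]) = (1 - p)%:E ;
  erw_indep : mutually_independent P (erw_choice X U eps) ;
  erw_step : forall n, (1 <= n)%N ->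
    forall w, X n.+1 w = eps n w * X (U n w) w }.

Definition position X (n : nat) (w : T) : int := \sum_(1 <= i < n.+1) X i w.

Definition position_sigma_algebra X (m : nat) : set (set T) :=
  <<s \bigcup_(i in `I_m.+1) g_sigma_algebra_preimage (position X i) >>.

Definition T0 X (w : T) : \bar R :=
  ereal_inf [set n%:R%:E | n in [set n | (1 <= n)%N /\ position X n w = 0]].

Definition T0_gt X (n : nat) : set T := [set w | (n%:R%:E < T0 X w)%E].

End elephant_random_walk.

Arguments elephant_random_walk {d T R} P p q X U eps.

Section harmonic.
Context (R : realType).
Implicit Types (p q : R) (m : nat) (y : int).

Definition a p (n : nat) : R := Gamma n%:R / Gamma (n%:R + 2 * p - 1).

(* Only the values at (0, 0) and at (m, y) with m > 0 and y <> 0 are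
   meaningful. *)
Definition h p m y : R := if m == 0%N then a p 1 else a p m * `|y|%:~R.

(* The one-step expectation of f (S_(m+1)) under the law of the walk started
   from y at time m; the first case is meaningful for y = 0 only.  For m >= 1
   the weights are the transition probabilities as a formula in y, also when
   |y| > m. *)
Definition one_step_expectation p q m y (f : int -> R) : R :=
  if m == 0%N then q * f 1 + (1 - q) * f (-1)
  else f (y + 1) * (1 / 2 + (p - 1 / 2) * (y%:~R / m%:R))
     + f (y - 1) * (1 / 2 - (p - 1 / 2) * (y%:~R / m%:R)).

End harmonic.

(* Main.v *)
Require Import Defs.
From mathcomp Require Import all_boot all_order all_algebra finmap.
From mathcomp Require Import ring lra zify.
From mathcomp Require Import all_classical all_reals all_analysis.
From mathcomp Require Import measurable_realfun.
Import Order.TTheory GRing.Theory Num.Theory.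
Import numFieldNormedType.Exports.
Local Open Scope classical_set_scope.
Local Open Scope ring_scope.

(** Write [al = 2p - 1] and let u_N(m, y) be the probability that the walk
started from y at time m avoids 0 up to time N.  By the Markov property,
P(A | T0 > N) is a finite sum over the +-1 paths of length m, each weighted by
its probability times u_N(m, S_m) / u_N(1, 1).  So everything rests on the ratio
limit
  u_N(m, y) / u_N(1, 1)  -->  |y| a_m / a_1        (y = m mod 2, |y| <= m),
which is [survival_ratio_cvg].

The transition probabilities are symmetric under y -> -y, so the reflection
principle gives, for y >= 0, u_N(m, y) = E_(m,y)[sgn S_N] for the walk that is
not killed ([survival_reflection]).  The drift is linear in y; hence the central
difference D(y) = E_(m,y+1)[sgn S_N] - E_(m,y-1)[sgn S_N] satisfies again the
backward equation of such a walk, with drift coefficient al/(m+al) instead of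
al/m, up to the factor prod (1 + al/i) ([central_diff_walk_mean]).  Thus
u_N(m, y), for y > 0, is half the sum over the y sites j = y-1, y-3, ..., 1-y of
constant multiples of K_N(m, j), the mean under this shifted walk of a function
concentrated on {-1, 0, 1}.  It remains to see that K_N(m, j) / K_N(1, 0) --> 1.

- K_N is even and unimodal in space, which makes K_N(m, 0) nondecreasing in odd
  m.  Waiting for the first visit to 0 therefore yields
  K_N(m, j) >= K_N(1, 0) (1 - v_N(m, j)), with v_N the probability that the
  shifted walk avoids 0 up to time N ([central_mean_ge_survival]).
- The shifted walk is recurrent because al <= 1/2: |y| / sqrt m is then
  a supermartingale away from 0, and its conditional variances add up to a
  multiple of the harmonic series, so it cannot stay positive and bounded
  ([survival_mul_clock_le]).  Hence v_N --> 0.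
- K_N(1, 0) is an average of the K_N(m, .) with positive weights.  As no ratio
  is asymptotically below 1, none can be asymptotically above 1
  ([central_mean_ratio_cvg]).

The constant prod_(i < m) (1 + al/i) equals a_1 / a_m by the functional equation
of Gamma, which also gives the harmonicity of h. *)

(** * Walks with linear drift: reflection and central differences *)

Section linear_drift.
Local Set Implicit Arguments.
Local Unset Strict Implicit.
Context (R : realType).
Implicit Types (c : nat -> R) (f : int -> R) (k m : nat) (y : int).

(** The k-step mean of [f] for the walk on the integers that goes, at time m
from y, to y +- 1 with probability (1 +- c m * y) / 2.  It is defined by the
backward equation for all y, so that it makes sense as an algebraic expression
also where these weights leave [0, 1]. *)
Fixpoint walk_mean c k m f y : R :=
  if k is k'.+1 then
    (1 + c m * y%:~R) / 2 * walk_mean c k' m.+1 f (y + 1)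
    + (1 - c m * y%:~R) / 2 * walk_mean c k' m.+1 f (y - 1)
  else f y.

(** The backward equation of the same walk killed at 0; starting at 0 already
counts as a visit. *)
Fixpoint survival c k m y : R :=
  if y == 0 then 0 else
  if k is k'.+1 then
    (1 + c m * y%:~R) / 2 * survival c k' m.+1 (y + 1)
    + (1 - c m * y%:~R) / 2 * survival c k' m.+1 (y - 1)
  else 1.

Definition signum y : R := Num.sg y%:~R.

Definition central_diff f y : R := f (y + 1) - f (y - 1).

Lemma survival0 c k m : survival c k m 0 = 0.
Proof. by case: k. Qed.

Lemma walk_mean_odd c f : (forall y, f (- y) = - f y) ->
  forall k m y, walk_mean c k m f (- y) = - walk_mean c k m f y.
Proof.
move=> f_odd; elim=> [|k IH] m y //=.
have -> : - y + 1 = - (y - 1) by lia.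
have -> : - y - 1 = - (y + 1) by lia.
by rewrite !IH rmorphN /=; ring.
Qed.

Lemma walk_mean_even c f : (forall y, f (- y) = f y) ->
  forall k m y, walk_mean c k m f (- y) = walk_mean c k m f y.
Proof.
move=> f_even; elim=> [|k IH] m y //=.
have -> : - y + 1 = - (y - 1) by lia.
have -> : - y - 1 = - (y + 1) by lia.
by rewrite !IH rmorphN /=; ring.
Qed.

Lemma signumN y : signum (- y) = - signum y.
Proof. by rewrite /signum rmorphN sgrN. Qed.

(** Reflection principle: after a visit to 0 the sign has mean zero, so the
signed mean only counts the paths that avoid 0. *)
Lemma survival_reflection c k m y : 0 <= y ->
  survival c k m y = walk_mean c k m signum y.
Proof.
elim: k m y => [|k IH] m y y_ge0 /=.
  rewrite /signum; case: eqVneq => [->|y_neq0]; first by rewrite sgr0.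
  by rewrite gtr0_sg // ltr0z lt_def y_neq0.
case: eqVneq => [->|y_neq0]; last by rewrite !IH //; lia.
rewrite sub0r add0r walk_mean_odd; last exact: signumN.
by ring.
Qed.

Lemma survivalN c k m y : survival c k m (- y) = survival c k m y.
Proof.
elim: k m y => [|k IH] m y /=; first by rewrite oppr_eq0.
rewrite oppr_eq0; case: eqP => // _.
have -> : - y + 1 = - (y - 1) by lia.
have -> : - y - 1 = - (y + 1) by lia.
by rewrite !IH rmorphN /=; ring.
Qed.

(** One step of the walk, differenced in space, has the weights
(1 + c (y + 1)) / 2 and (1 - c (y - 1)) / 2.  They add up to 1 + c; dividing by
this total leaves a linear drift with coefficient c / (1 + c). *)
Lemma central_diff_walk_mean c c' f k m y :
  (forall n, (m <= n)%N -> 1 + c n != 0) ->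
  (forall n, (m <= n)%N -> c' n = c n / (1 + c n)) ->
  central_diff (walk_mean c k m f) y
  = (\prod_(m <= i < m + k) (1 + c i)) * walk_mean c' k m (central_diff f) y.
Proof.
elim: k m y => [|k IH] m y c_neq c'E.
  by rewrite addn0 big_geq // mul1r.
rewrite big_ltn; last by lia.
rewrite -addSnnS /=.
have IH' y' : central_diff (walk_mean c k m.+1 f) y' = _ :=
  IH m.+1 y' (fun n h => c_neq n (ltnW h)) (fun n h => c'E n (ltnW h)).
have e1 := IH' (y + 1); have e2 := IH' (y - 1).
rewrite /central_diff in e1 e2 |- *.
rewrite addrK in e1; rewrite subrK in e2; rewrite /= addrK subrK.
set P := \prod_(_ <= _ < _) _ in e1 e2 |- *.
have -> : (y + 1)%:~R = y%:~R + 1 :> R by rewrite intrD.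
have -> : (y - 1)%:~R = y%:~R - 1 :> R by rewrite intrB.
rewrite c'E //.
set A := walk_mean c' k m.+1 _ (y + 1) in e1 |- *.
set B := walk_mean c' k m.+1 _ (y - 1) in e2 |- *.
(* The outer values are eliminated through the induction hypothesis; the middle
   value, at y, cancels. *)
have -> : walk_mean c k m.+1 f (y + 1 + 1) = P * A + walk_mean c k m.+1 f y.
  by rewrite -e1 subrK.
have -> : walk_mean c k m.+1 f (y - 1 - 1) = walk_mean c k m.+1 f y - P * B.
  by rewrite -e2; ring.
by field; rewrite c_neq.
Qed.

End linear_drift.

Section elephant_drift.
Local Set Implicit Arguments.
Local Unset Strict Implicit.
Context (R : realType) (al : R).
Hypotheses (al_gtN1 : -1 < al) (al_le : al <= 2^-1).
Implicit Types (f : int -> R) (k m : nat) (y : int).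

Definition elephant_drift m : R := al / m%:R.
Definition shifted_drift m : R := al / (m%:R + al).

Lemma shifted_time_gt0 m : (0 < m)%N -> 0 < m%:R + al.
Proof. by rewrite -(ler1n R) => m_ge1; move: al_gtN1; lra. Qed.

Lemma one_plus_elephant_drift_gt0 m : (0 < m)%N -> 0 < 1 + elephant_drift m.
Proof.
move=> m_gt0; have m_ge1 : 1 <= m%:R :> R by rewrite ler1n.
rewrite /elephant_drift -ltrBlDl sub0r ltr_pdivlMr; move: al_gtN1; lra.
Qed.

Lemma shifted_driftE m : (0 < m)%N ->
  shifted_drift m = elephant_drift m / (1 + elephant_drift m).
Proof.
move=> m_gt0; have m_ge1 : 1 <= m%:R :> R by rewrite ler1n.
rewrite /shifted_drift /elephant_drift; field.
by apply/andP; split; move: al_gtN1; lra.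
Qed.

Lemma mul_drift_bound (m : nat) (z : R) : (0 < m)%N -> `|z| <= m%:R ->
  - m%:R < al * z < m%:R.
Proof.
move=> m_gt0 zm; have m_ge1 : 1 <= m%:R :> R by rewrite ler1n.
rewrite -ltr_norml normrM.
have al_lt1 : `|al| < 1.
  by rewrite ltr_norml; apply/andP; split; move: al_gtN1 al_le; lra.
by apply: le_lt_trans (ler_wpM2l _ zm) _ => //; rewrite gtr_pMl //; lra.
Qed.

Lemma elephant_weight_gt0 m y : (0 < m)%N -> (`|y| <= m)%N ->
  0 < 1 + elephant_drift m * y%:~R.
Proof.
move=> m_gt0 ym; have m_ge1 : 1 <= m%:R :> R by rewrite ler1n.
have m_gt0' : 0 < m%:R :> R by lra.
have yr : `|y%:~R : R| <= m%:R.
  by rewrite -intr_norm -abszE -mulrz_nat ler_int; lia.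
have /andP[ym1 ym2] := mul_drift_bound m_gt0 yr.
have -> : 1 + elephant_drift m * y%:~R = (m%:R + al * y%:~R) / m%:R.
  by rewrite /elephant_drift; field; lra.
by rewrite divr_gt0 //; lra.
Qed.

(** The central difference at y involves the sites y - 1 and y + 1, so it only
concerns |y| <= m - 1; on this range the weights of the shifted walk are
positive. *)
Lemma shifted_weight_gt0 m y : (`|y| < m)%N ->
  0 < 1 + shifted_drift m * y%:~R.
Proof.
move=> ym; have m_gt0 : (0 < m)%N by lia.
have ma := shifted_time_gt0 m_gt0.
have yr : `|y%:~R + 1 : R| <= m%:R.
  by rewrite -[1]/(1%:~R) -intrD -intr_norm -abszE -mulrz_nat ler_int; lia.
have /andP[ym1 ym2] := mul_drift_bound m_gt0 yr.
have -> : 1 + shifted_drift m * y%:~R = (m%:R + al * (y%:~R + 1)) / (m%:R + al).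
  by rewrite /shifted_drift; field; lra.
by rewrite divr_gt0 //; lra.
Qed.

Lemma elephant_weightB_gt0 m y : (0 < m)%N -> (`|y| <= m)%N ->
  0 < 1 - elephant_drift m * y%:~R.
Proof.
move=> m_gt0 ym; have := @elephant_weight_gt0 m (- y) m_gt0.
by rewrite rmorphN mulrN abszN; apply.
Qed.

Lemma shifted_weightB_gt0 m y : (`|y| < m)%N ->
  0 < 1 - shifted_drift m * y%:~R.
Proof.
move=> ym; have := @shifted_weight_gt0 m (- y).
by rewrite rmorphN mulrN abszN; apply.
Qed.

End elephant_drift.

Section shifted_walk.
Local Set Implicit Arguments.
Local Unset Strict Implicit.
Context (R : realType) (al : R).
Hypotheses (al_gtN1 : -1 < al) (al_le : al <= 2^-1).
Implicit Types (f : int -> R) (k m : nat) (y : int).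

Local Notation c := (shifted_drift al).

Let weightD_gt0 m y : (`|y| < m)%N -> 0 < 1 + c m * y%:~R.
Proof. exact: shifted_weight_gt0. Qed.

Let weightB_gt0 m y : (`|y| < m)%N -> 0 < 1 - c m * y%:~R.
Proof. exact: shifted_weightB_gt0. Qed.

Let absD1 m y : (`|y| < m)%N -> (`|(y + 1)%R| < m.+1)%N. Proof. lia. Qed.
Let absB1 m y : (`|y| < m)%N -> (`|(y - 1)%R| < m.+1)%N. Proof. lia. Qed.

Lemma walk_mean_ge0 f : (forall y, 0 <= f y) ->
  forall k m y, (`|y| < m)%N -> 0 <= walk_mean c k m f y.
Proof.
move=> f_ge0; elim=> [|k IH] m y ym //=.
have wD := weightD_gt0 ym; have wB := weightB_gt0 ym.
apply: addr_ge0; apply: mulr_ge0; rewrite ?IH ?absD1 ?absB1 //;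
  by apply: divr_ge0 => //; apply: ltW.
Qed.

Lemma survival_le1 k m y : (`|y| < m)%N -> survival c k m y <= 1.
Proof.
elim: k m y => [|k IH] m y ym /=; case: eqP => // _.
have wD := weightD_gt0 ym; have wB := weightB_gt0 ym.
have sD := IH _ _ (absD1 ym); have sB := IH _ _ (absB1 ym).
nra.
Qed.

(** The decrease from y - 1 to y + 1 propagates backwards because, by the
computation behind [central_diff_walk_mean], the difference at (m, y) is a
combination of those at (m + 1, y + 1) and (m + 1, y - 1) with nonnegative
weights; for y = 1 the second one vanishes by evenness. *)
Lemma walk_mean_unimodal f : (forall y, f (- y) = f y) ->
  (forall y, 1 <= y -> f (y + 1) <= f (y - 1)) ->
  forall k m y, 1 <= y -> y + 1 < m%:Z ->
  walk_mean c k m f (y + 1) <= walk_mean c k m f (y - 1).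
Proof.
move=> f_even f_uni; elim=> [|k IH] m y y_ge1 ym; first exact: f_uni.
rewrite /= addrK subrK.
have wD : 0 < 1 + c m * (y + 1)%:~R by apply: weightD_gt0; lia.
have wB : 0 < 1 - c m * (y - 1)%:~R by apply: weightB_gt0; lia.
have gD : walk_mean c k m.+1 f (y + 1 + 1) <= walk_mean c k m.+1 f y.
  by rewrite -[in leRHS](addrK 1 y); apply: IH; lia.
(* For y = 1 this is an equality between the values at 1 and -1. *)
have gB : walk_mean c k m.+1 f y <= walk_mean c k m.+1 f (y - 1 - 1).
  have [->|y_neq1] := eqVneq y 1.
    by rewrite subrr sub0r walk_mean_even.
  by rewrite -[in leLHS](subrK 1 y); apply: IH; lia.
move: wD wB; rewrite intrD intrB.
set a := walk_mean _ _ _ _ (y + 1 + 1) in gD *.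
set b := walk_mean _ _ _ _ y in gD gB *.
set d := walk_mean _ _ _ _ (y - 1 - 1) in gB *.
move: (c m) y%:~R => e z wD wB.
have hD : 0 <= (1 + e * (z + 1)) * (b - a).
  by apply: mulr_ge0; [exact: ltW|rewrite subr_ge0].
have hB : 0 <= (1 - e * (z - 1)) * (d - b).
  by apply: mulr_ge0; [exact: ltW|rewrite subr_ge0].
lra.
Qed.

(** K_N(m, y) of the introduction, with N = m + k. *)
Definition central_mean k m y : R :=
  walk_mean c k m (central_diff (@signum R)) y.

Lemma central_diff_signum_even y :
  central_diff (@signum R) (- y) = central_diff (@signum R) y.
Proof.
rewrite /central_diff.
have -> : - y + 1 = - (y - 1) by lia.
have -> : - y - 1 = - (y + 1) by lia.
by rewrite !signumN opprK addrC.
Qed.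

Lemma signum_sgz y : signum R y = (sgz y)%:~R.
Proof. by rewrite /signum sgrEz sgz_int. Qed.

Lemma central_diff_signum_ge0 y : 0 <= central_diff (@signum R) y.
Proof. rewrite /central_diff !signum_sgz subr_ge0 ler_int; lia. Qed.

Lemma central_diff_signum_unimodal y : 1 <= y ->
  central_diff (@signum R) (y + 1) <= central_diff (@signum R) (y - 1).
Proof.
by move=> y_ge1; rewrite /central_diff !signum_sgz -!intrB ler_int; lia.
Qed.

Lemma central_mean_ge0 k m y : (`|y| < m)%N -> 0 <= central_mean k m y.
Proof. exact/walk_mean_ge0/central_diff_signum_ge0. Qed.

(** From 0 the walk moves to +-1, where evenness identifies the two values, and
then to 0 or +-2, where the mean is at most that at 0 by unimodality. *)
Lemma central_mean0_step k m : (0 < m)%N ->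
  central_mean k.+2 m 0 <= central_mean k m.+2 0.
Proof.
move=> m_gt0.
have -> : central_mean k.+2 m 0 = central_mean k.+1 m.+1 1.
  rewrite {1}/central_mean /= sub0r add0r.
  have /= -> := walk_mean_even c central_diff_signum_even k.+1 m.+1 1.
  by rewrite -/(central_mean _ _ _) /central_mean /=; field.
have := walk_mean_unimodal central_diff_signum_even central_diff_signum_unimodal
  k (m := m.+2) (lexx 1).
rewrite -!/(central_mean _ _ _) subrr => /(_ ltac:(lia)) h.
have wD : 0 < 1 + c m.+1 * 1%:~R by apply: weightD_gt0.
rewrite {1}/central_mean /= subrr -!/(central_mean _ _ _).
have {}h : 0 <= (1 + c m.+1 * 1%:~R)
    * (central_mean k m.+2 0 - central_mean k m.+2 (1 + 1)).
  by apply: mulr_ge0; [exact: ltW|rewrite subr_ge0].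
lra.
Qed.

Lemma central_mean0_nondecreasing k m : odd m ->
  central_mean (m.-1 + k) 1 0 <= central_mean k m 0.
Proof.
move=> m_odd; rewrite -(odd_double_half m) m_odd /= add0n.
elim: m./2 k => [|j IH] k; first by rewrite double0.
by rewrite doubleS !addSn -!addnS; apply: le_trans (IH _) (central_mean0_step _ _).
Qed.

(** Stop the walk at its first visit to 0.  The parity condition makes this time
odd, where the mean is at least [central_mean (m.-1 + k) 1 0]; on the event that
0 is not visited the mean is bounded below by 0. *)
Lemma central_mean_ge_survival k m y : (`|y| < m)%N -> odd (m + `|y|) ->
  central_mean (m.-1 + k) 1 0 * (1 - survival c k m y) <= central_mean k m y.
Proof.
elim: k m y => [|k IH] m y ym m_odd.
  rewrite /=; case: eqVneq => [y0|y0].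
    rewrite subr0 mulr1 y0 central_mean0_nondecreasing // -(addn0 m).
    by move: m_odd; rewrite y0.
  by rewrite subrr mulr0 central_mean_ge0.
have [y0|y0] := eqVneq y 0.
  rewrite y0 survival0 subr0 mulr1 central_mean0_nondecreasing // -(addn0 m).
  by move: m_odd; rewrite y0.
have wD := weightD_gt0 ym; have wB := weightB_gt0 ym.
have hD := IH _ _ (absD1 ym) ltac:(lia).
have hB := IH _ _ (absB1 ym) ltac:(lia).
rewrite /= (negbTE y0) [central_mean k.+1 m y]/central_mean /= -!/(central_mean _ _ _).
have e : (m.-1 + k.+1 = m + k)%N by lia.
rewrite -[m.+1.-1]/m -e in hD hB.
move: hD hB; set K := central_mean _ 1 0.
rewrite -![_ * (1 - _) <= _]subr_ge0 => hD hB.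
have := addr_ge0 (mulr_ge0 (ltW wD) hD) (mulr_ge0 (ltW wB) hB).
lra.
Qed.

End shifted_walk.

(** * Recurrence of the shifted walk *)

Section recurrence.
Local Set Implicit Arguments.
Local Unset Strict Implicit.
Context (R : realType) (al : R).
Hypotheses (al_gtN1 : -1 < al) (al_le : al <= 2^-1).
Implicit Types (f : int -> R) (k m : nat) (y : int).

Local Notation c := (shifted_drift al).

Lemma one_sub_sqr_gt0 : 0 < 1 - al ^+ 2.
Proof.
have -> : 1 - al ^+ 2 = (1 - al) * (1 + al) by ring.
by apply: mulr_gt0; move: al_gtN1 al_le; lra.
Qed.

(** A lower bound for the conditional variances of y / sqrt m accumulated between
the times m and m + k. *)
Definition clock k m : R := (1 - al ^+ 2) * \sum_(m <= i < m + k) i.+1%:R^-1.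

Lemma clockS k m : clock k.+1 m = (1 - al ^+ 2) / m.+1%:R + clock k m.+1.
Proof. by rewrite /clock addnS big_ltn ?ltnS ?leq_addr // mulrDr addSn. Qed.

Lemma clock_ge0 k m : 0 <= clock k m.
Proof.
apply: mulr_ge0; first exact/ltW/one_sub_sqr_gt0.
by apply: sumr_ge0 => i _; rewrite invr_ge0.
Qed.

(** The supermartingale property of |y| / sqrt m away from 0.  The critical value
al = 1/2 enters here: as the drift increases with al, the claim reduces to
4 m (m + 1) <= (2 m + 1) ^ 2. *)
Lemma sqrt_drift m : (0 < m)%N ->
  (1 + c m) / Num.sqrt m.+1%:R <= (Num.sqrt m%:R)^-1.
Proof.
move=> m_gt0; have m_ge1 : 1 <= m%:R :> R by rewrite ler1n.
have ma := shifted_time_gt0 al_gtN1 m_gt0.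
have rm : 0 < Num.sqrt m%:R :> R by rewrite sqrtr_gt0; lra.
have rS : 0 < Num.sqrt m.+1%:R :> R by rewrite sqrtr_gt0 ltr0n.
rewrite ler_pdivrMr // mulrC ler_pdivlMr //.
have c_le : 1 + c m <= (2 * m%:R + 2) / (2 * m%:R + 1).
  have -> : 1 + c m = (m%:R + 2 * al) / (m%:R + al).
    by rewrite /shifted_drift; field; lra.
  rewrite ler_pdivrMr // mulrAC ler_pdivlMr; last lra.
  by move: al_le => h; nra.
apply: (le_trans (ler_wpM2r (ltW rm) c_le)).
rewrite -ler_sqr ?nnegrE; [|by rewrite mulr_ge0 ?divr_ge0 //; lra|exact: ltW].
rewrite exprMn !sqr_sqrtr ?ler0n // expr_div_n mulrAC ler_pdivrMr; last nra.
by rewrite -natr1; nra.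
Qed.

(** Let x = y / sqrt m and Q(x) = x (2 L - x).  Until x exceeds [L], each step
decreases Q on average by at least the increment of the clock; since Q is
nonnegative up to 2 L, the probability of remaining in (0, L] is at most Q / clock.
The probability of exceeding [L] is at most x / L.  The two bounds are proved
together by induction on the number of steps. *)
Lemma survival_mul_clock_le (L : R) k m y : 1 <= L -> 0 <= y -> y < m%:Z ->
  let x := y%:~R / Num.sqrt m%:R in x <= 2 * L ->
  clock k m * survival c k m y <= clock k m * (x / L) + x * (2 * L - x).
Proof.
move=> L_ge1.
have L_gt0 : 0 < L by lra.
(* Beyond L the bound holds because a survival probability is at most 1. *)
have trivial_bound (D sv x : R) : 0 <= D -> sv <= 1 -> L <= x -> x <= 2 * L ->
    D * sv <= D * (x / L) + x * (2 * L - x).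
  move=> D_ge0 sv_le1 Lx xL.
  have h1 : D * sv <= D * (x / L).
    by apply: ler_wpM2l => //; apply: le_trans sv_le1 _; rewrite ler_pdivlMr ?mul1r.
  have : 0 <= x * (2 * L - x) by apply: mulr_ge0; lra.
  lra.
elim: k m y => [|k IH] m y y_ge0 ym x xL.
  have -> : clock 0 m = 0 by rewrite /clock addn0 big_geq // mulr0.
  rewrite !mul0r add0r mulr_ge0 //; last by rewrite subr_ge0.
  by rewrite divr_ge0 ?sqrtr_ge0 // ler0z.
have [y0|y_neq0] := eqVneq y 0.
  rewrite /x y0 survival0 mulr0 !mul0r mulr0 addr0 //.
have m_gt0 : (0 < m)%N by lia.
have ym1 : y + 1 <= m%:Z by lia.
have y1_ge0 : 0 <= y - 1 by lia.
have yD1_ge0 : 0 <= y + 1 by lia.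
have yB1_le : y - 1 <= y + 1 by lia.
have lt_mS y' : y' <= y + 1 -> y' < m.+1%:Z by lia.
have abs_ym : (`|y| < m)%N by lia.
have := @survival_le1 _ _ al_gtN1 al_le k.+1 m y abs_ym.
have [Lx sv_le1|xL' sv_le1] := leP L x.
  by apply: trivial_bound => //; exact: clock_ge0.
have m_ge1 : 1 <= m%:R :> R by rewrite ler1n.
have ma := shifted_time_gt0 al_gtN1 m_gt0.
have rm : 0 < Num.sqrt m%:R :> R by rewrite sqrtr_gt0; lra.
have rS : 0 < Num.sqrt m.+1%:R :> R by rewrite sqrtr_gt0 ltr0n.
have rS2 : Num.sqrt m.+1%:R ^+ 2 = m.+1%:R :> R by rewrite sqr_sqrtr ?ler0n.
have rS1 : 1 <= Num.sqrt m.+1%:R :> R.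
  by rewrite -[leLHS]sqrtr1 ler_sqrt ?ler1n ?ltr0n.
have rmS : Num.sqrt m%:R <= Num.sqrt m.+1%:R :> R.
  by rewrite ler_sqrt ?ltr0n // ler_nat.
have z_ge1 : 1 <= y%:~R :> R by rewrite (ler_int R 1) -gtz0_ge1 lt_def y_neq0.
(* Supermartingale property, and the bound on the squared drift that keeps the
   conditional variance at least (1 - al ^ 2) / (m + 1). *)
have drift_x : (1 + c m) * y%:~R / Num.sqrt m.+1%:R <= x.
  rewrite mulrAC /x [leRHS]mulrC; apply: ler_wpM2r; first lra.
  exact: sqrt_drift.
have wD := shifted_weight_gt0 al_gtN1 al_le abs_ym.
have wB := shifted_weightB_gt0 al_gtN1 al_le abs_ym.
have cz : (c m * y%:~R) ^+ 2 <= al ^+ 2.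
  rewrite /shifted_drift mulrAC -mulrA exprMn ler_piMr ?sqr_ge0 //.
  have : 0 <= y%:~R / (m%:R + al) by rewrite divr_ge0 //; lra.
  have : y%:~R / (m%:R + al) <= 1.
    rewrite ler_pdivrMr // mul1r.
    have : (y + 1)%:~R <= m%:Z%:~R :> R by rewrite ler_int.
    rewrite intrD -pmulrn.
    by move: al_gtN1; lra.
  by move=> h1 h2; rewrite expr_le1.
have step y' : 0 <= y' -> y' <= y + 1 ->
    clock k m.+1 * survival c k m.+1 y'
    <= clock k m.+1 * ((y'%:~R / Num.sqrt m.+1%:R) / L)
       + y'%:~R / Num.sqrt m.+1%:R * (2 * L - y'%:~R / Num.sqrt m.+1%:R).
  move=> y'_ge0 y'_le; apply: IH => //; first exact: lt_mS.
  have : y'%:~R / Num.sqrt m.+1%:R <= (y%:~R + 1) / Num.sqrt m.+1%:R :> R.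
    have y'_le' : y'%:~R <= (y + 1)%:~R :> R by rewrite ler_int.
    by rewrite ler_pM2r ?invr_gt0 // -[1]/(1%:~R) -intrD.
  have h1 : y%:~R / Num.sqrt m.+1%:R <= x.
    by apply: ler_wpM2l; [lra|rewrite lef_pV2 ?posrE].
  have h2 : 1 / Num.sqrt m.+1%:R <= 1 :> R by rewrite ler_pdivrMr // mul1r.
  rewrite mulrDl; lra.
have := step (y + 1) yD1_ge0 (lexx _); have := step (y - 1) y1_ge0 yB1_le.
have -> : clock k.+1 m
    = (1 - al ^+ 2) / Num.sqrt m.+1%:R ^+ 2 + clock k m.+1.
  by rewrite rS2 clockS.
move: sv_le1; rewrite /= (negbTE y_neq0) intrB intrD.
move: (survival c k m.+1 (y + 1)) (survival c k m.+1 (y - 1)).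
move: (clock k m.+1) (clock_ge0 k m.+1).
move=> D D_ge0 sp sm sv_le1 hm hp.
have x_ge0 : 0 <= x by apply: divr_ge0; lra.
move: x_ge0 drift_x wD wB cz z_ge1 xL xL' sv_le1 hm hp.
clear - L_gt0 rS D_ge0 al_gtN1 al_le.
move: (Num.sqrt m.+1%:R) rS (c m) (y%:~R : R) x => s s_gt0 e z x.
move=> x_ge0 drift_x wD wB cz z_ge1 xL xL' sv_le1 hm hp.
set xi := (1 + e) * z / s in drift_x.
pose sv := (1 + e * z) / 2 * sp + (1 - e * z) / 2 * sm.
rewrite -/sv in sv_le1 *.
have hsum := addr_ge0 (mulr_ge0 (ltW wD) (etrans (subr_ge0 _ _) hp))
                      (mulr_ge0 (ltW wB) (etrans (subr_ge0 _ _) hm)).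
have {hsum hp hm} hsum : D * sv <= D * (xi / L) + 2 * L * xi - xi ^+ 2
    - (1 - (e * z) ^+ 2) / s ^+ 2.
  rewrite -subr_ge0; apply: (le_trans (divr_ge0 hsum (ler0n _ 2))).
  by rewrite le_eqVlt; apply/orP; left; apply/eqP; rewrite /sv /xi; field; rewrite !gt_eqF.
have v_ge0 : 0 <= (1 - al ^+ 2) / s ^+ 2.
  by apply: divr_ge0; [exact/ltW/one_sub_sqr_gt0|exact: sqr_ge0].
have v_le : (1 - al ^+ 2) / s ^+ 2 <= (1 - (e * z) ^+ 2) / s ^+ 2.
  by apply: ler_wpM2r; [rewrite invr_ge0 sqr_ge0|lra].
clearbody xi sv; move: hsum v_ge0 v_le.
move: ((1 - al ^+ 2) / s ^+ 2) ((1 - (e * z) ^+ 2) / s ^+ 2) => v v'.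
move=> hsum v_ge0 v_le.
have h1 : D * (xi / L) <= D * (x / L).
  by apply: ler_wpM2l => //; apply: ler_wpM2r => //; rewrite invr_ge0 ltW.
have h2 : 0 <= (2 * L - x - xi) * (x - xi) by apply: mulr_ge0; lra.
have h3 : v * sv <= v by apply: ler_piMr.
rewrite (mulrDl v D (x / L)) (mulrDl v D sv); have h4 : 0 <= v * (x / L).
  by apply: mulr_ge0 => //; apply: divr_ge0 => //; lra.
lra.
Qed.

End recurrence.

(** * The ratio limit for survival probabilities *)

Section ratio_limit.
Local Set Implicit Arguments.
Local Unset Strict Implicit.
Context (R : realType) (al : R).
Hypotheses (al_gtN1 : -1 < al) (al_le : al <= 2^-1).
Implicit Types (f : int -> R) (k m : nat) (y : int).

Local Notation c := (shifted_drift al).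
Local Notation c0 := (elephant_drift al).

Lemma clock_cvgy m : clock al k m @[k --> \oo] --> +oo.
Proof.
have a_gt0 := one_sub_sqr_gt0 al_gtN1 al_le.
apply/cvgryPge => A.
have : series (@harmonic R) n @[n --> \oo] --> +oo.
  apply: nondecreasing_dvgn_lt; last exact: dvg_harmonic.
  apply/nondecreasing_seqP => n; rewrite /series /=.
  by rewrite big_nat_recr //= lerDl ltW // invr_gt0 ltr0n.
move=> /cvgryPge /(_ (A / (1 - al ^+ 2) + series (@harmonic R) m)) [K _ HK].
exists K => // k /= Kk; have /= := HK (m + k)%N (leq_trans Kk (leq_addl _ _)).
rewrite /series /= [X in _ <= X -> _](big_cat_nat (n := m)) ?leq_addr //=.
rewrite [X in _ <= X -> _]addrC lerD2r.
by rewrite ler_pdivrMr // mulrC.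
Qed.

Lemma survival_ge0 k m y : (`|y| < m)%N -> 0 <= survival c k m y.
Proof.
elim: k m y => [|k IH] m y ym /=; case: eqP => // _.
have wD := shifted_weight_gt0 al_gtN1 al_le ym.
have wB := shifted_weightB_gt0 al_gtN1 al_le ym.
by apply: addr_ge0; apply: mulr_ge0; try (by apply: IH; lia);
  apply: divr_ge0 => //; exact: ltW.
Qed.

Lemma survival_shifted_cvg0 m y : (`|y| < m)%N ->
  survival c k m y @[k --> \oo] --> (0 : R).
Proof.
wlog y_ge0 : y / 0 <= y => [hw ym|ym].
  have [|y_lt0] := leP 0 y; first by move/hw; apply.
  rewrite -[y]opprK; under eq_fun do rewrite survivalN.
  by apply: hw; [lia|rewrite abszN].
have s_ge0 k : 0 <= survival c k m y by exact: survival_ge0.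
pose x : R := y%:~R / Num.sqrt m%:R.
have x_ge0 : 0 <= x by rewrite divr_ge0 ?sqrtr_ge0 // ler0z.
apply/cvgrPdist_le => e e_gt0.
(* With this L the term x / L is at most e / 2. *)
pose L := 1 + 2 * x / e.
have xe_ge0 : 0 <= 2 * x / e by apply: divr_ge0; lra.
have L_ge1 : 1 <= L by rewrite /L lerDl.
have xL : x / L <= e / 2.
  rewrite ler_pdivrMr; last lra.
  have -> : e / 2 * L = x + e / 2 by rewrite /L; field; rewrite gt_eqF.
  lra.
have /cvgryPge /(_ (1 + 2 * L ^+ 2 / e)) [K _ HK] := clock_cvgy m.
exists K => // k /= /HK /= Dk.
have ym' : y < m%:Z by lia.
rewrite sub0r normrN ger0_norm //.
have [xL2|xL2] := leP x (2 * L); last first.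
  have := survival_le1 al_gtN1 al_le k ym => s_le1.
  apply: le_trans s_le1 _; apply: ltW; have : 2 < x / L by rewrite ltr_pdivlMr //; lra.
  by nra.
have /= main := survival_mul_clock_le al_gtN1 al_le k L_ge1 y_ge0 ym' xL2.
rewrite -/x in main.
have L2 : x * (2 * L - x) <= L ^+ 2 by have := sqr_ge0 (L - x); nra.
have L2e : 0 <= 2 * L ^+ 2 / e.
  by apply: divr_ge0; [have := sqr_ge0 L|]; lra.
have D_gt0 : 0 < clock al k m by lra.
rewrite -(ler_pM2l D_gt0); apply: le_trans main _.
have h1 := ler_wpM2l (ltW D_gt0) xL.
have h2 : L ^+ 2 <= clock al k m * (e / 2).
  apply: (@le_trans _ _ ((1 + 2 * L ^+ 2 / e) * (e / 2))).
    have -> : (1 + 2 * L ^+ 2 / e) * (e / 2) = e / 2 + L ^+ 2.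
      by field; rewrite gt_eqF.
    by rewrite lerDr; lra.
  by apply: ler_wpM2r => //; lra.
lra.
Qed.

Lemma survival_elephant_gt0 k m y : (0 < m)%N -> 0 < y -> y <= m%:Z ->
  0 < survival c0 k m y.
Proof.
have ge0 k' m' y' : (0 < m')%N -> (`|y'| <= m')%N -> 0 <= survival c0 k' m' y'.
  elim: k' m' y' => [|k' IH] m' y' m'_gt0 y'm' /=; case: eqP => // _.
  have wD := elephant_weight_gt0 al_gtN1 al_le m'_gt0 y'm'.
  have wB := elephant_weightB_gt0 al_gtN1 al_le m'_gt0 y'm'.
  by apply: addr_ge0; apply: mulr_ge0; try (by apply: IH; lia);
    apply: divr_ge0 => //; exact: ltW.
elim: k m y => [|k IH] m y m_gt0 y_gt0 ym /=; rewrite gt_eqF //.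
have abs_ym : (`|y| <= m)%N by lia.
have wD := elephant_weight_gt0 al_gtN1 al_le m_gt0 abs_ym.
have wB := elephant_weightB_gt0 al_gtN1 al_le m_gt0 abs_ym.
apply: ltr_wpDr.
  by apply: mulr_ge0; [apply: divr_ge0 => //; exact: ltW|apply: ge0; lia].
by apply: mulr_gt0; [apply: divr_gt0|apply: IH; lia].
Qed.

(** The sum telescopes from -n to n, and the signed mean is odd. *)
Lemma survival_elephantE k m n : (0 < m)%N ->
  survival c0 k m n%:Z = (\prod_(m <= i < m + k) (1 + c0 i)) / 2
    * \sum_(0 <= i < n) central_mean al k m (n%:Z - 1 - 2 * i%:Z).
Proof.
move=> m_gt0; rewrite survival_reflection //.
pose W := walk_mean c0 k m (@signum R).
have telescope n' : W n - W (n%:Z - 2 * n'%:Z)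
    = \sum_(0 <= i < n') central_diff W (n%:Z - 1 - 2 * i%:Z).
  elim: n' => [|n' IH]; first by rewrite big_geq // mulr0 subr0 subrr.
  rewrite big_nat_recr //= -IH /central_diff.
  have -> : n%:Z - 1 - 2 * n'%:Z + 1 = n%:Z - 2 * n'%:Z by lia.
  have -> : n%:Z - 1 - 2 * n'%:Z - 1 = n%:Z - 2 * n'.+1%:Z by lia.
  by ring.
have := telescope n.
have -> : n%:Z - 2 * n%:Z = - n%:Z by lia.
rewrite [W (- _)]walk_mean_odd; last exact: signumN.
rewrite opprK -/(W n) => W2.
have -> : W n = 2^-1 * (W n + W n) by field.
rewrite W2 mulrAC mulrC; congr (_ / 2); rewrite mulr_sumr.
apply: eq_bigr => i _; apply: central_diff_walk_mean => j mj.
  by rewrite gt_eqF // one_plus_elephant_drift_gt0 //; lia.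
by apply: shifted_driftE => //; lia.
Qed.

Lemma central_mean1_gt0 k : 0 < central_mean al k 1 0.
Proof.
have := @survival_elephant_gt0 k 1 1 isT isT isT.
rewrite survival_elephantE // big_nat1 mulr0 subr0 subrr.
rewrite pmulr_rgt0 // divr_gt0 //; rewrite big_seq_cond.
apply: prodr_gt0 => i; rewrite andbT mem_index_iota => /andP[i_gt0 _].
exact: one_plus_elephant_drift_gt0.
Qed.

(** The lower bound is [central_mean_ge_survival].  For the upper bound, (m + 1, y)
has a predecessor (m, y - s) with s = +-1; there the ratio tends to 1 by
induction and is an average, with positive weights, of the ratios at (m + 1, y)
and (m + 1, y - 2 s). *)
Lemma central_mean_ratio_cvg m y : (`|y| < m)%N -> odd (m + `|y|) ->
  central_mean al k m y / central_mean al (m.-1 + k) 1 0 @[k --> \oo]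
    --> (1 : R).
Proof.
elim: m y => [|m IH] y ym m_odd; first by lia.
case: m IH ym m_odd => [|m] IH ym m_odd.
  have -> : y = 0 by lia.
  rewrite (_ : (fun _ => _) = fun=> 1); first exact: cvg_cst.
  by apply/funext => k; rewrite add0n divff // gt_eqF // central_mean1_gt0.
(* The predecessor lies closer to 0; from y = 0 it is the site 1, which is in
   range since m is then odd. *)
have [s [s1 ys]] : exists s : int, (s == 1) || (s == -1) /\ (`|(y - s)%R| < m.+1)%N.
  have [y_gt0|y_le0] := ltP 0 y; first by exists 1; split => //; lia.
  by exists (- 1); split => //; lia.
pose w : R := s%:~R * (c m.+1 * (y - s)%:~R).
have step k : central_mean al k.+1 m.+1 (y - s)
    = (1 + w) / 2 * central_mean al k m.+2 y
      + (1 - w) / 2 * central_mean al k m.+2 (y - 2 * s).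
  rewrite [LHS]/central_mean /= -!/(central_mean _ _ _ _) /w.
  have [/eqP ->|/eqP ->] := orP s1.
    have -> : y - 1 - 1 = y - 2 * 1 by lia.
    by rewrite subrK; ring.
  have -> : y - -1 + 1 = y - 2 * -1 by lia.
  by rewrite addrK; ring.
have wD := shifted_weight_gt0 al_gtN1 al_le ys.
have wB := shifted_weightB_gt0 al_gtN1 al_le ys.
have [w_gtN1 w_lt1] : 0 < 1 + w /\ 0 < 1 - w.
  move: wD wB; rewrite /w; have [/eqP ->|/eqP ->] := orP s1.
    by rewrite mul1r.
  by rewrite mulN1r => h1 h2; split=> //; rewrite [X in _ + X]opprK.
have ys2 : (`|(y - 2 * s)%R| < m.+2)%N by move: s1 => /orP[] /eqP e; lia.
have odd1 : odd (m.+1 + `|(y - s)%R|) by move: s1 => /orP[] /eqP e; lia.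
have odd2 : odd (m.+2 + `|(y - 2 * s)%R|) by move: s1 => /orP[] /eqP e; lia.
have lower z k : (`|z| < m.+2)%N -> odd (m.+2 + `|z|) ->
    1 - survival c k m.+2 z
    <= central_mean al k m.+2 z / central_mean al (m.+1 + k) 1 0.
  move=> zm z_odd; rewrite ler_pdivlMr ?central_mean1_gt0 // mulrC.
  exact: (central_mean_ge_survival al_gtN1 al_le k zm z_odd).
apply: (@squeeze_cvgr _ _ _ _ (fun k => 1 - survival c k m.+2 y) (fun k =>
    (central_mean al k.+1 m.+1 (y - s) / central_mean al (m + k.+1) 1 0
     - (1 - w) / 2 * (1 - survival c k m.+2 (y - 2 * s))) / ((1 + w) / 2))).
- apply: nearW => k; rewrite lower //= ler_pdivlMr; last by lra.
  have := lower _ k ys2 odd2; rewrite step addnS -addSn.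
  set D := central_mean al (m.+1 + k) 1 0.
  have D_gt0 : 0 < D by exact: central_mean1_gt0.
  set a := central_mean al k m.+2 y; set b := central_mean al k m.+2 _.
  have -> : ((1 + w) / 2 * a + (1 - w) / 2 * b) / D
      = a / D * ((1 + w) / 2) + (1 - w) / 2 * (b / D).
    by field; rewrite gt_eqF.
  have h := divr_ge0 (ltW w_lt1) (ler0n R 2).
  by move=> /(ler_wpM2l h); lra.
- rewrite -[X in _ --> X]subr0; apply: cvgB; first exact: cvg_cst.
  exact: survival_shifted_cvg0.
- rewrite [X in _ --> X](_ : _ = (1 - (1 - w) / 2 * (1 - 0)) / ((1 + w) / 2));
    last first.
    by field; rewrite gt_eqF.
  apply: cvgM; last exact: cvg_cst.
  apply: cvgB.
    have := IH (y - s) ys odd1.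
    by rewrite -cvg_shiftS.
  apply: cvgM; first exact: cvg_cst.
  apply: cvgB; first exact: cvg_cst.
  exact: survival_shifted_cvg0.
Qed.

(** The ratio limit: each of the [n] terms of [survival_elephantE] contributes the
same amount in the limit. *)
Lemma survival_ratio_cvg m n : (0 < m)%N -> (n <= m)%N -> ~~ odd (m + n) ->
  survival c0 k m n%:Z / survival c0 (m.-1 + k) 1 1 @[k --> \oo]
    --> n%:R / \prod_(1 <= i < m) (1 + c0 i).
Proof.
move=> m_gt0 nm mn_even.
have prod_gt0 k l : (0 < k)%N -> 0 < \prod_(k <= i < l) (1 + c0 i).
  move=> k_gt0; rewrite big_seq_cond; apply: prodr_gt0 => i.
  rewrite andbT mem_index_iota => /andP[ki _].
  by apply: one_plus_elephant_drift_gt0 => //; lia.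
rewrite (_ : (fun _ => _) = fun k => (\sum_(0 <= i < n)
    central_mean al k m (n%:Z - 1 - 2 * i%:Z) / central_mean al (m.-1 + k) 1 0)
    / \prod_(1 <= i < m) (1 + c0 i)); last first.
  apply/funext => k; rewrite (survival_elephantE _ _ m_gt0).
  have := @survival_elephantE (m.-1 + k) 1 1 isT => /= ->.
  rewrite big_nat1 mulr0 subr0 subrr addnA add1n prednK //.
  rewrite (@big_cat_nat _ _ _ m 1) ?leq_addr //= -mulr_suml.
  have := central_mean1_gt0 (m.-1 + k).
  have := prod_gt0 1%N m isT; have := prod_gt0 m (m + k)%N m_gt0.
  move=> h1 h2 h3; field; by rewrite !gt_eqF.
apply: cvgM; last exact: cvg_cst.
rewrite (_ : n%:R = \sum_(0 <= i < n) 1); last first.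
  by rewrite sumr_const_nat subn0.
rewrite big_mkord (_ : (fun k => _) = (fun k => \sum_(i < n)
  (central_mean al k m (n%:Z - 1 - 2 * (i : nat)%:Z) / central_mean al (m.-1 + k) 1 0)));
  last by apply/funext => k; rewrite big_mkord.
apply: cvg_big => [|i _]; first exact: add_continuous.
have := ltn_ord i => i_lt.
by apply: central_mean_ratio_cvg; lia.
Qed.

End ratio_limit.

(** * The functional equation of Gamma *)

Section gamma.
Local Set Implicit Arguments.
Local Unset Strict Implicit.
Context (R : realType).
Implicit Types (x t : R) (n : nat).
Local Notation mu := (@lebesgue_measure R).

Definition gamma_fun x t : R := t `^ (x - 1) * expR (- t).

Definition gamma_integral x : \bar R :=
  (\int[mu]_(t in `]0%R, +oo[) (gamma_fun x t)%:E)%E.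

Lemma GammaE x : Gamma x = fine (gamma_integral x).
Proof. by []. Qed.

Lemma gamma_fun_ge0 x t : 0 <= gamma_fun x t.
Proof. by rewrite mulr_ge0 ?powR_ge0 ?expR_ge0. Qed.

Lemma measurable_gamma_fun x (D : set R) : measurable_fun D (gamma_fun x).
Proof.
apply: measurable_funTS; apply: measurable_funM => //.
exact: measurableT_comp.
Qed.

Lemma measurable_gamma_funE x (D : set R) :
  measurable_fun D (fun t => (gamma_fun x t)%:E).
Proof. by apply/measurable_EFinP; exact: measurable_gamma_fun. Qed.

(** Compact intervals that exhaust the half-line, away from 0 so that t ^ (x - 1)
is continuous on them also for x < 1. *)
Definition exhaust n : set R := `[n.+2%:R^-1, n.+2%:R]%classic.

Lemma bigcup_exhaust : \bigcup_n exhaust n = `]0%R, +oo[%classic.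
Proof.
apply/seteqP; split => [t [n _]|t] /=; rewrite /exhaust /= !in_itv /= ?andbT.
  by move=> /andP[+ _]; apply: lt_le_trans; rewrite invr_gt0.
move=> t_gt0.
have bound_le (i j : nat) : (i <= (i + j).+2)%N /\ (j <= (i + j).+2)%N by lia.
exists (Num.bound t + Num.bound t^-1)%N => //=.
rewrite in_itv /=; apply/andP; split.
  rewrite invf_ple ?posrE //; apply/ltW/(lt_le_trans (archi_boundP _)).
    by rewrite invr_ge0 ltW.
  by rewrite ler_nat; exact: (bound_le _ _).2.
apply/ltW/(lt_le_trans (archi_boundP _)); first exact: ltW.
by rewrite ler_nat; exact: (bound_le _ _).1.
Qed.

Lemma cvg_exhaust x :
  (\int[mu]_(t in exhaust n) (gamma_fun x t)%:E)%E @[n --> \oo]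
    --> gamma_integral x.
Proof.
rewrite /gamma_integral -bigcup_exhaust.
apply: ge0_nondecreasing_set_cvg_integral.
- apply/nondecreasing_seqP => n; rewrite subsetEset => t.
  rewrite /exhaust /= !in_itv /= => /andP[nt tn]; apply/andP; split.
    by apply: le_trans nt; rewrite lef_pV2 ?posrE // ler_nat.
  by apply: le_trans tn _; rewrite ler_nat.
- by move=> n; exact: measurable_itv.
- by move=> n; exact: measurable_gamma_funE.
- by move=> n t _; rewrite lee_fin gamma_fun_ge0.
Qed.

Lemma derive1_NexpRN t : (fun u : R => - expR (- u))^`()%classic t = expR (- t).
Proof.
rewrite derive1N // derive1_comp // derive1N // derive1_id derive1E.
by have /funeqP -> := @derive_expR R; rewrite mulrN1 opprK.
Qed.

Lemma continuous_expRN : continuous (fun u : R => expR (- u)).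
Proof.
move=> t; apply: continuous_comp; last exact: continuous_expR.
exact: (@continuousN _ R^o).
Qed.

Lemma powR_continuous_gt0 x t : 0 < t -> {for t, continuous (@powR R ^~ x)}.
Proof.
move=> t_gt0; apply: differentiable_continuous; apply/derivable1_diffP.
by apply: derivable_powR; rewrite in_itv /= t_gt0.
Qed.

Lemma gamma_by_parts x n : 0 < x ->
  (\int[mu]_(t in exhaust n) (gamma_fun (x + 1) t)%:E
   = (gamma_fun (x + 1) n.+2%:R^-1 - gamma_fun (x + 1) n.+2%:R)%:E
     + x%:E * \int[mu]_(t in exhaust n) (gamma_fun x t)%:E)%E.
Proof.
move=> x_gt0; set a := n.+2%:R^-1; set b := n.+2%:R.
have a_gt0 : 0 < a by rewrite invr_gt0.
have b_gt1 : 1 < b by rewrite ltr1n.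
have ab : a < b.
  by apply: (@lt_trans _ _ 1) => //; rewrite invf_lt1 // ltr0n.
have itv_gt0 t : t \in `[a, b] -> 0 < t.
  by rewrite in_itv /= => /andP[/(lt_le_trans a_gt0)].
have c_at z t : t \in `[a, b] -> {for t, continuous (@powR R ^~ z)}.
  by move=> /itv_gt0; exact: powR_continuous_gt0.
have a_in : a \in `[a, b] by rewrite in_itv /= lexx ltW.
have b_in : b \in `[a, b] by rewrite in_itv /= lexx ltW.
have oo_cc t : t \in `]a, b[ -> t \in `[a, b].
  by rewrite !in_itv /= => /andP[/ltW -> /ltW ->].
have ibp := @integration_by_parts R (@powR R ^~ x) (fun t => - expR (- t))
  (fun t => x * t `^ (x - 1)) (fun t => expR (- t)) a b ab.
rewrite /exhaust -/a -/b.
transitivity (\int[mu]_(t in `[a, b]) (t `^ x * expR (- t))%:E)%E.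
  by apply: eq_integral => t _; rewrite /gamma_fun addrK.
rewrite ibp; last 6 first.
- apply: derivable_within_continuous => t t_ab; apply: derivableM => //.
  by apply: derivable_powR; rewrite in_itv /= itv_gt0.
- split.
  + by move=> t /oo_cc /itv_gt0 t_gt0; apply: derivable_powR; rewrite in_itv /= t_gt0.
  + by apply/cvg_at_right_filter; exact: c_at.
  + by apply/cvg_at_left_filter; exact: c_at.
- by move=> t /oo_cc /itv_gt0 t_gt0; rewrite powR_derive1 // in_itv /= t_gt0.
- apply: continuous_subspaceT; exact: continuous_expRN.
- split.
  + by move=> t _; exact: ex_derive.
  + by apply/cvg_at_right_filter; apply: cvgN; exact: continuous_expRN.
  + by apply/cvg_at_left_filter; apply: cvgN; exact: continuous_expRN.
- by move=> t _; rewrite derive1_NexpRN.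
rewrite /gamma_fun !addrK; congr (_ + _)%E; first by congr (_%:E); ring.
transitivity (- \int[mu]_(t in `[a, b]) - (x%:E * (gamma_fun x t)%:E))%E.
  congr (- _)%E; apply: eq_integral => t _.
  by rewrite -EFinM -EFinN; congr (_%:E); rewrite /gamma_fun; ring.
rewrite integral_ge0N; last first.
  by move=> t _; rewrite -EFinM lee_fin mulr_ge0 ?gamma_fun_ge0 // ltW.
rewrite oppeK ge0_integralZl //.
- exact: measurable_gamma_funE.
- by move=> t _; rewrite lee_fin gamma_fun_ge0.
- by rewrite lee_fin ltW.
Qed.

Lemma gamma_fun_cvg0r x : 0 < x ->
  gamma_fun (x + 1) n.+2%:R^-1 @[n --> \oo] --> (0 : R).
Proof.
move=> x_gt0; apply: (@squeeze_cvgr _ _ _ _ (cst 0) (fun n => n.+2%:R^-1 `^ x)).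
- apply: nearW => n; rewrite gamma_fun_ge0 /= /gamma_fun addrK.
  by apply: ler_piMr; rewrite ?powR_ge0 // expR_le1 oppr_le0 invr_ge0.
- exact: cvg_cst.
- apply: (cvg_at_rightP (fun u => u `^ x) 0 0).1; first exact: powR_cvg0.
  split=> [n|]; first by rewrite invr_gt0.
  have := @cvg_harmonic R; by rewrite -cvg_shiftS.
Qed.

Lemma gamma_fun_cvg0y x : gamma_fun (x + 1) n.+2%:R @[n --> \oo] --> (0 : R).
Proof.
(* t ^ x <= t ^ k, and exp t >= t ^ (k + 1) / (k + 1)!, which leaves a factor
   1 / t. *)
pose k := (Num.bound x).+1.
have xk : x <= k%:R.
  have [x_ge0|x_lt0] := leP 0 x; last by rewrite (le_trans (ltW x_lt0)).
  apply/ltW/(lt_le_trans (archi_boundP x_ge0)); rewrite ler_nat; exact: leqnSn.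
apply: (@squeeze_cvgr _ _ _ _ (cst 0) (fun n => k.+1`!%:R * n.+2%:R^-1)).
- apply: nearW => n; rewrite gamma_fun_ge0 /= /gamma_fun addrK.
  set t : R := n.+2%:R; have t_gt1 : 1 < t by rewrite ltr1n.
  have t_gt0 : 0 < t by lra.
  apply: (@le_trans _ _ (t ^+ k * expR (- t))).
    by apply: ler_wpM2r; rewrite ?expR_ge0 // -powR_mulrn ?ler_powR // ltW.
  have := expR_ge1Dxn k (ltW t_gt0).
  rewrite expRN ler_pdivrMr ?expR_gt0 // => h.
  have f_gt0 : 0 < k.+1`!%:R :> R by rewrite ltr0n fact_gt0.
  have h' : t ^+ k.+1 / k.+1`!%:R <= expR t by lra.
  rewrite mulrAC ler_pdivlMr // -exprSr mulrC.
  by rewrite -ler_pdivrMr.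
- exact: cvg_cst.
- rewrite -[X in _ --> X](mulr0 (k.+1`!%:R : R)).
  apply: cvgMl_tmp; have := @cvg_harmonic R; by rewrite -cvg_shiftS.
Qed.

(** Integration by parts on the exhausting intervals, whose boundary terms vanish
at both ends.  The identity holds in the extended reals; finiteness is deduced
from it below. *)
Lemma gamma_integralS x : 0 < x ->
  gamma_integral (x + 1) = (x%:E * gamma_integral x)%E.
Proof.
move=> x_gt0.
suff h : (\int[mu]_(t in exhaust n) (gamma_fun (x + 1) t)%:E)%E @[n --> \oo]
    --> (x%:E * gamma_integral x)%E.
  exact: (cvg_unique _ (cvg_exhaust (x := x + 1)) h).
under eq_fun do rewrite gamma_by_parts //.
rewrite -(add0e (x%:E * gamma_integral x)%E); apply: cvgeD => //.
  apply: cvg_EFin; first exact: nearW.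
  rewrite -[X in _ --> X](subrr (0 : R)); apply: cvgB.
    exact: gamma_fun_cvg0r.
  exact: gamma_fun_cvg0y.
by apply: cvgeZl => //; exact: cvg_exhaust.
Qed.

Lemma gamma_integral_ge0 x : (0 <= gamma_integral x)%E.
Proof. by apply: integral_ge0 => t _; rewrite lee_fin gamma_fun_ge0. Qed.

Lemma gamma_integral1_lty : (gamma_integral 1 < +oo)%E.
Proof.
apply: (@le_lt_trans _ _ 1%E); last exact: ltry.
rewrite -(@integral_exponential_pdf R 1 ltr01) /gamma_integral.
have -> : (\int[mu]_(t in `]0%R, +oo[) (gamma_fun 1 t)%:E
    = \int[mu]_(t in `]0%R, +oo[) (exponential_pdf 1 t)%:E)%E.
  apply: eq_integral => t; rewrite inE /= in_itv /= andbT => t_gt0.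
  by rewrite exponential_pdfE ?ltW // /gamma_fun subrr powRr0 !mul1r mulN1r.
apply: ge0_subset_integral => //.
  by apply/measurable_EFinP; exact: measurable_exponential_pdf.
by move=> t _; rewrite lee_fin exponential_pdf_ge0.
Qed.

Lemma gamma_integral_nat_lty n : (gamma_integral n.+1%:R < +oo)%E.
Proof.
elim: n => [|n IH]; first exact: gamma_integral1_lty.
rewrite -natr1 gamma_integralS ?ltr0n //.
by rewrite lte_mul_pinfty // ?lee_fin.
Qed.

(** For z >= 1, t ^ (z - 1) <= 1 + t ^ n as soon as n >= z, which bounds the
integral by two values at integers; for smaller x the functional equation is
used backwards. *)
Lemma gamma_integral_lty x : 0 < x -> (gamma_integral x < +oo)%E.
Proof.
have ge1_lty z : 1 <= z -> (gamma_integral z < +oo)%E.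
  move=> z_ge1; have z_ge0 : 0 <= z by lra.
  pose n := (Num.bound z).
  have zn : z <= n%:R by exact/ltW/archi_boundP.
  apply: (@le_lt_trans _ _ (gamma_integral 1 + gamma_integral n.+1%:R)%E).
    rewrite /gamma_integral -ge0_integralD //.
    - apply: ge0_le_integral => //.
      + by move=> t _; rewrite lee_fin gamma_fun_ge0.
      + exact: measurable_gamma_funE.
      + by apply: emeasurable_funD; exact: measurable_gamma_funE.
      + move=> t; rewrite /= in_itv /= andbT => t_gt0.
        rewrite -EFinD lee_fin /gamma_fun -mulrDl.
        apply: ler_wpM2r; rewrite ?expR_ge0 // subrr powRr0 -natr1 addrK.
        have [t_le1|t_gt1] := leP t 1.
          apply: (@le_trans _ _ 1); last by rewrite lerDl powR_ge0.
          rewrite -[leRHS](powRr0 t); apply: ger_powR; last by lra.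
          by rewrite t_gt0.
        apply: (@le_trans _ _ (t `^ n%:R)); last by rewrite lerDr.
        by apply: ler_powR; lra.
    - by move=> t _; rewrite lee_fin gamma_fun_ge0.
    - exact: measurable_gamma_funE.
    - by move=> t _; rewrite lee_fin gamma_fun_ge0.
    - exact: measurable_gamma_funE.
  by rewrite lte_add_pinfty ?gamma_integral1_lty ?gamma_integral_nat_lty.
move=> x_gt0; have : (gamma_integral (x + 1) < +oo)%E by apply: ge1_lty; lra.
rewrite gamma_integralS //; case: (gamma_integral x) (gamma_integral_ge0 x) => // [r _ _|_].
  exact: ltry.
by rewrite gt0_muley ?lte_fin.
Qed.

Lemma gamma_integral_gt0 x : 0 < x -> (0 < gamma_integral x)%E.
Proof.
(* On [1, 2] the integrand is at least t ^ (-1) * exp (- 2) >= e. *)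
move=> x_gt0; pose e : R := expR (- 2) / 2.
have e_gt0 : 0 < e by rewrite divr_gt0 ?expR_gt0.
apply: (@lt_le_trans _ _ (\int[mu]_(t in `[1%R, 2%R]) e%:E)%E).
  rewrite integral_cst //= lebesgue_measure_itv /= lte_fin ltr1n.
  by rewrite -EFinD -EFinM lte_fin mulr_gt0 //; lra.
apply: (@le_trans _ _ (\int[mu]_(t in `[1%R, 2%R]) (gamma_fun x t)%:E)%E).
  apply: ge0_le_integral => //.
  - by move=> t _; rewrite lee_fin ltW.
  - exact: measurable_gamma_funE.
  - move=> t; rewrite /= in_itv /= => /andP[t_ge1 t_le2].
    rewrite lee_fin /e /gamma_fun mulrC; apply: ler_pM => //.
    + apply: (@le_trans _ _ (t `^ (-1))).
        by rewrite powR_inv1 ?lef_pV2 ?posrE //; lra.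
      by apply: ler_powR; lra.
    + by rewrite ler_expR; lra.
apply: ge0_subset_integral => //.
- exact: measurable_gamma_funE.
- by move=> t _; rewrite lee_fin gamma_fun_ge0.
- by move=> t; rewrite /= !in_itv /= andbT => /andP[t_ge1 _]; lra.
Qed.

Lemma Gamma_gt0 x : 0 < x -> 0 < Gamma x.
Proof.
by move=> x_gt0; rewrite GammaE fine_gt0 // gamma_integral_gt0 ?gamma_integral_lty.
Qed.

Lemma GammaS x : 0 < x -> Gamma (x + 1) = x * Gamma x.
Proof.
move=> x_gt0; rewrite !GammaE gamma_integralS // fineM //.
by rewrite ge0_fin_numE ?gamma_integral_ge0 ?gamma_integral_lty.
Qed.

End gamma.

(** * The law of the elephant random walk *)

Section partition_of_events.
Local Set Implicit Arguments.
Local Unset Strict Implicit.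
Context d (T : measurableType d) (R : realType) (P : probability T R).

(** The part of [B] outside of the events F_i lies in the part of [A] outside of
them, which is a null set because their masses add up to that of [A]. *)
Lemma probability_partition n (F : 'I_n -> set T) (A B : set T) :
  measurable A -> measurable B -> (forall i, measurable (F i)) ->
  trivIset setT F -> B `<=` A ->
  (P A = \sum_(i < n) P (A `&` F i))%E -> (P B = \sum_(i < n) P (B `&` F i))%E.
Proof.
move=> mA mB mF tF BA PA.
pose C := \big[setU/set0]_(i < n) F i.
have mC : measurable C by exact: bigsetU_measurable.
have PI D : measurable D -> (P (D `&` C) = \sum_(i < n) P (D `&` F i))%E.
  move=> mD; rewrite /C big_distrr /= measure_bigsetU_ord //.
    by move=> i; exact: measurableI.
  exact: trivIset_setIl.
have cancelA x : (P A = x + P A)%E -> x = 0%E.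
  have : P A \is a fin_num by exact: fin_num_measure.
  by case: (P A) => // s _; case: x => // r [] e; congr (_%:E); lra.
have PDI D : measurable D -> (P D = P (D `\` C) + P (D `&` C))%E.
  by move=> mD; exact: measureDI.
have PAC : P (A `\` C) = 0%E.
  by apply: cancelA; rewrite {1}(PDI A mA) (PI A mA) -PA.
rewrite (PDI B mB) (PI B mB) [X in (X + _)%E](_ : _ = 0%E) ?add0e //.
apply/eqP; rewrite eq_le measure_ge0 andbT -PAC.
apply: le_measure; rewrite ?inE; [exact: measurableD|exact: measurableD|].
exact: setSD.
Qed.

End partition_of_events.

Section path_law.
Local Set Implicit Arguments.
Local Unset Strict Implicit.
Context d (T : measurableType d) (R : realType) (P : probability T R).
Context (p q : R) (X : nat -> {RV P >-> int}) (U : nat -> {RV P >-> nat}).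
Context (eps : nat -> {RV P >-> int}).
Hypothesis erw : elephant_random_walk P p q X U eps.
Implicit Types (s : seq int).

Local Notation c0 := (elephant_drift (2 * p - 1)).
Local Notation choice := (erw_choice X U eps).

(** Paths are listed with the most recent step first, so that prolonging a path
is consing. *)
Fixpoint path_event s : set T :=
  if s is e :: s' then X (size s) @^-1` [set e] `&` path_event s' else setT.

Fixpoint path_weight s : R :=
  if s is e :: s' then
    if s' is [::] then (if e == 1 then q else 1 - q)
    else path_weight s' * ((1 + c0 (size s') * (e * \sum_(x <- s') x)%:~R) / 2)
  else 1.

Arguments path_weight : simpl never.

Lemma path_weight_cons e s : s != [::] ->
  path_weight (e :: s)
  = path_weight s * ((1 + c0 (size s) * (e * \sum_(x <- s) x)%:~R) / 2).
Proof. by case: s. Qed.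

Definition is_step (e : int) := (e == 1) || (e == -1).

(** The choices U_j and eps_j with j >= n, which act only on the steps after
time n.  The indices of [erw_choice] are shifted by one. *)
Definition future n (i : option (nat + nat)) : bool :=
  if i is Some (inl k | inr k) then (n <= k.+1)%N else false.

Lemma measurable_RV_preimage d' (T' : measurableType d') (Y : {RV P >-> T'}) B :
  measurable B -> measurable (Y @^-1` B).
Proof. by move=> mB; rewrite -[_ @^-1` _]setTI; exact: measurable_funP. Qed.

Lemma measurable_choice i A : choice i A -> measurable A.
Proof.
by case: i => [[k|k]|] [B mB <-]; rewrite setTI; exact: measurable_RV_preimage.
Qed.

Lemma choice_X B : choice None (X 1%N @^-1` B).
Proof. by exists B => //; rewrite setTI. Qed.

Lemma choice_U k B : choice (Some (inl k)) (U k.+1 @^-1` B).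
Proof. by exists B => //; rewrite setTI. Qed.

Lemma choice_eps k B : choice (Some (inr k)) (eps k.+1 @^-1` B).
Proof. by exists B => //; rewrite setTI. Qed.

Lemma measurable_path_event s : measurable (path_event s).
Proof.
elim: s => [|e s IH] //=; apply: measurableI => //.
exact: measurable_RV_preimage.
Qed.

Lemma path_event_nth s w i : path_event s w -> (i < size s)%N ->
  X (size s - i)%N w = nth 0 s i.
Proof.
elim: s i => [|e s IH] //= [|i] [/= Xe sw]; first by rewrite subn0.
by rewrite ltnS subSS; exact: IH.
Qed.

Lemma is_step_sqr e : is_step e -> e * e = 1.
Proof. by case/orP => /eqP ->. Qed.

Lemma is_stepM e e' : is_step e -> is_step e' -> is_step (e * e').
Proof. by case/orP => /eqP ->; case/orP => /eqP ->. Qed.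

Lemma probability_eps n e : (0 < n)%N -> is_step e ->
  P (eps n @^-1` [set e]) = ((1 + (2 * p - 1) * e%:~R) / 2)%:E.
Proof.
move=> n_gt0 /orP[] /eqP ->.
  by rewrite (erw_sign_pos erw n_gt0); congr (_%:E); field.
by rewrite (erw_sign_neg erw n_gt0); congr (_%:E); field.
Qed.

Definition extend_family (I : eqType) (i : I) (B : set T) (E : I -> set T) j :=
  if j == i then B else E j.

Lemma bigcap_extend_family (I : choiceType) (i : I) B E (J : {fset I}) :
  i \notin J ->
  \bigcap_(j in [set` (i |` J)%fset]) extend_family i B E j
  = B `&` \bigcap_(j in [set` J]) E j.
Proof.
move=> iJ; rewrite eqEsubset; split=> w /=.
  move=> h; split; first by have := h i (fset1U1 _ _); rewrite /extend_family eqxx.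
  move=> j /= jJ; have := h j (fset1Ur _ jJ); rewrite /extend_family.
  by case: eqVneq => // ji; rewrite ji (negbTE iJ) in jJ.
move=> [Bw h] j /=; rewrite /extend_family !inE.
by case: eqVneq => //= _ /h.
Qed.

Lemma prod_extend_family (I : choiceType) (i : I) B E (J : {fset I}) :
  i \notin J ->
  (\prod_(j <- (i |` J)%fset) P (extend_family i B E j)
   = P B * \prod_(j <- J) P (E j))%E.
Proof.
move=> iJ; rewrite big_fsetU1 //= {1}/extend_family eqxx; congr (_ * _)%E.
rewrite [in LHS]big_seq [in RHS]big_seq; apply: eq_bigr => j jJ.
by rewrite /extend_family; case: eqVneq => // ji; rewrite ji (negbTE iJ) in jJ.
Qed.

Lemma next_stepE n e k x w : (0 < n)%N -> is_step x ->
  U n w = k -> X k w = x -> X n.+1 w = e <-> eps n w = e * x.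
Proof.
move=> n_gt0 x_step Uk Xk; rewrite (erw_step erw n_gt0) Uk Xk.
by split=> [<-|->]; rewrite -mulrA is_step_sqr ?mulr1.
Qed.

(** The law of the path together with its independence from all future choices;
the latter is what makes the induction work.  Given the path s of length n, the
next step is e exactly if U_n = n - i and eps_n = e * s_i for some i, and the
choices U_n and eps_n are future for s.  Summing over i gives
(1 / n) * sum_i (1 + al * e * s_i) / 2 = (1 + al / n * e * sum s) / 2. *)
Lemma path_indep s (J : {fset option (nat + nat)}) E :
  s != [::] -> all is_step s ->
  {in J, forall i, future (size s) i} -> (forall i, i \in J -> choice i (E i)) ->
  P (path_event s `&` \bigcap_(i in [set` J]) E i)
  = ((path_weight s)%:E * \prod_(i <- J) P (E i))%E.
Proof.
elim: s J E => [|e s IH] J E //= _ /andP[e_step s_steps] J_future E_choice.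
case: s IH s_steps J_future => [|e0 s0] IH s_steps J_future.
  have NJ : None \notin J by apply/negP => /J_future.
  rewrite /= setIT -(bigcap_extend_family _ _ NJ) (erw_indep erw); last first.
    move=> j; rewrite !inE /extend_family; case: eqVneq => [->|_] //= jJ.
      exact: choice_X.
    exact: E_choice.
  rewrite prod_extend_family //; congr (_ * _)%E.
  rewrite /path_weight; move: e_step => /orP[] /eqP -> /=; first exact: (erw_first_pos erw).
  exact: (erw_first_neg erw).
set s := e0 :: s0 in IH s_steps J_future *; set n := size s in J_future *.
have n_gt0 : (0 < n)%N by [].
(* Indices of the choices U_n and eps_n, where n = (size s0).+1. *)
pose iU : option (nat + nat) := Some (inl (size s0)).
pose ieps : option (nat + nat) := Some (inr (size s0)).
have epsJ : ieps \notin J by apply/negP => /J_future /=; rewrite ltnn.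
have UJ : iU \notin (ieps |` J)%fset.
  by rewrite !inE /=; apply/negP => /J_future /=; rewrite ltnn.
set G := \bigcap_(i in _) _.
have mG : measurable G.
  by apply: fin_bigcap_measurable => // i /E_choice; exact: measurable_choice.
pose x i := nth 0 s i.
have x_step (i : 'I_n) : is_step (x i) by exact: (all_nthP 0 s_steps).
have mB : measurable (X n.+1 @^-1` [set e] `&` path_event s `&` G).
  apply: measurableI => //; apply: measurableI; first exact: measurable_RV_preimage.
  exact: measurable_path_event.
have [g gE] : exists g, (\prod_(i <- J) P (E i))%E = g%:E.
  exists (fine (P G)); rewrite -(erw_indep erw E_choice) fineK //.
  exact: fin_num_measure.
rewrite (probability_partition (F := fun i : 'I_n => U n @^-1` [set (n - i)%N])
  measurableT mB) //; last 3 first.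
- by move=> i; exact: measurable_RV_preimage.
- apply/trivIsetP => i j _ _ ij; rewrite -subset0 => w [/= -> nij].
  case/eqP: ij; apply: val_inj => /=; apply/eqP.
  by rewrite -(eqn_sub2lE (ltnW (ltn_ord i)) (ltnW (ltn_ord j))) nij.
- rewrite probability_setT (eq_bigr (fun=> (n%:R^-1)%:E)) => [|i _].
    by rewrite sumEFin sumr_const card_ord -[_^-1 *+ _]mulr_natl divff ?pnatr_eq0.
  by rewrite setTI (erw_memory erw) // subn_gt0 ltn_ord leq_subr.
rewrite (eq_bigr (fun i : 'I_n => (path_weight s * (n%:R^-1 *
  ((1 + (2 * p - 1) * (e * x i)%:~R) / 2 * g)))%:E)) => [|i _].
  rewrite sumEFin gE -EFinM; congr (_%:E).
  rewrite path_weight_cons // -/n.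
  have -> : \sum_(x <- s) x = \sum_(i < n) x i.
    by rewrite (big_nth 0) big_mkord.
  rewrite rmorphM rmorph_sum /= /elephant_drift.
  rewrite (eq_bigr (fun i : 'I_n => path_weight s * n%:R^-1 * g / 2
    + path_weight s * n%:R^-1 * (2 * p - 1) * e%:~R * g / 2 * (x i)%:~R)); last first.
    by move=> i _; rewrite intrM; field; rewrite pnatr_eq0.
  rewrite big_split /= sumr_const card_ord -[X in X + _]mulr_natl.
  rewrite -[X in _ + X]mulr_sumr.
  by field; rewrite pnatr_eq0.
have ex_step : is_step (e * x i) by exact: is_stepM.
pose E' := extend_family iU (U n @^-1` [set (n - i)%N])
  (extend_family ieps (eps n @^-1` [set e * x i]) E).
have -> : X n.+1 @^-1` [set e] `&` path_event s `&` G
    `&` U n @^-1` [set (n - i)%N]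
  = path_event s `&` \bigcap_(j in [set` (iU |` (ieps |` J))%fset]) E' j.
  rewrite !bigcap_extend_family // -/G eqEsubset; split=> w.
    move=> [[[/= Xe sw] Gw] Uw]; split => //; split => //; split => //=.
    apply/(next_stepE _ n_gt0 (x_step i) Uw) => //.
    exact: path_event_nth.
  move=> [sw [Uw [/= epsw Gw]]]; split => //; split => //; split => //=.
  apply/(next_stepE _ n_gt0 (x_step i) Uw) => //.
  exact: path_event_nth.
rewrite IH //; last 2 first.
- move=> j; rewrite !inE => /or3P[/eqP ->|/eqP ->|/J_future] //=.
  by case: j => [[k|k]|] //=; exact: ltnW.
- move=> j; rewrite !inE /E' /extend_family.
  case: eqVneq => [->|_] /=; first by move=> _; exact: choice_U.
  case: eqVneq => [->|_] /=; first by move=> _; exact: choice_eps.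
  exact: E_choice.
rewrite !prod_extend_family // gE (erw_memory erw) ?subn_gt0 ?ltn_ord ?leq_subr //.
by rewrite probability_eps.
Qed.

Lemma probability_path s : all is_step s ->
  P (path_event s) = (path_weight s)%:E.
Proof.
case: s => [_|e s s_steps]; first exact: probability_setT.
have := @path_indep (e :: s) fset0 (fun=> setT) isT s_steps.
rewrite set_fset0 bigcap_set0 setIT big_seq_fset0 mule1; exact.
Qed.

End path_law.

Arguments path_weight {R} p q s : simpl never.

Section path_survival.
Local Set Implicit Arguments.
Local Unset Strict Implicit.
Context d (T : measurableType d) (R : realType) (P : probability T R).
Context (p q : R) (X : nat -> {RV P >-> int}) (U : nat -> {RV P >-> nat}).
Context (eps : nat -> {RV P >-> int}).
Hypothesis erw : elephant_random_walk P p q X U eps.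
Implicit Types (s : seq int).

Local Notation c0 := (elephant_drift (2 * p - 1)).
Local Notation path_event := (path_event X).
Local Notation path_weight := (path_weight p q).
Local Notation endpoint s := (\sum_(e <- s) e).

Lemma position0 w : position X 0 w = 0.
Proof. by rewrite /position big_geq. Qed.

Lemma positionS n w : position X n.+1 w = X n.+1 w + position X n w.
Proof. by rewrite /position big_nat_recr //= addrC. Qed.

Lemma position_path s w : path_event s w -> position X (size s) w = endpoint s.
Proof.
elim: s => [|e s IH] /=; first by rewrite position0 big_nil.
by move=> [/= Xe /IH sE]; rewrite positionS Xe sE big_cons.
Qed.

Lemma position_path_eq s w w' i : path_event s w -> path_event s w' ->
  (i <= size s)%N -> position X i w = position X i w'.
Proof.
move=> sw sw' i_le; rewrite /position big_nat [RHS]big_nat.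
apply: eq_bigr => j /andP[j_gt0 j_lt].
have j_le : (j <= size s)%N by lia.
have lt_s : (size s - j < size s)%N by lia.
have := path_event_nth sw lt_s; have := path_event_nth sw' lt_s.
by rewrite subKn // => -> ->.
Qed.

(** The integers carry the discrete sigma-algebra, so it suffices to measure the
fibres; those of a sum are countable unions. *)
Lemma measurable_position n : measurable_fun setT (position X n : T -> int).
Proof.
move=> _ B _; rewrite setTI.
have fiber z : measurable (position X n @^-1` [set z]).
  elim: n z => [|n IH] z.
    have [z0|z0] := eqVneq z 0.
      rewrite [X in measurable X](_ : _ = setT) //.
      by rewrite -subTset => w _ /=; rewrite position0 z0.
    rewrite [X in measurable X](_ : _ = set0) // -subset0 => w /=.
    by rewrite position0 => z0'; rewrite -z0' eqxx in z0.
  rewrite [X in measurable X](_ : _ = \bigcup_e (X n.+1 @^-1` [set e]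
      `&` position X n @^-1` [set z - e])); last first.
    rewrite eqEsubset; split=> w /=; rewrite positionS.
      by move=> <-; exists (X n.+1 w) => //; split=> //=; rewrite addrAC subrr add0r.
    by move=> [e _ [/= -> ->]]; rewrite addrC subrK.
  apply: countable_bigcupT_measurable => [|e]; first exact: countableP.
  by apply: measurableI => //; exact: measurable_RV_preimage.
rewrite [X in measurable X](_ : _ = \bigcup_z
  ((position X n @^-1` [set z]) `&` [set _ | B z])).
  apply: countable_bigcupT_measurable => [|z]; first exact: countableP.
  apply: measurableI => //.
  have [Bz|nBz] := pselect (B z).
    by rewrite [X in measurable X](_ : _ = setT) // -subTset.
  by rewrite [X in measurable X](_ : _ = set0) // -subset0.
rewrite eqEsubset; split=> w /=; first by exists (position X n w).
by move=> [z _ [/= ->]].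
Qed.

Lemma measurable_position_preimage n B : measurable (position X n @^-1` B).
Proof. by rewrite -[_ @^-1` _]setTI; exact: measurable_position. Qed.

Lemma path_weight_split s :
  path_weight (1 :: s) + path_weight (-1 :: s) = path_weight s.
Proof.
case: s => [|e s]; first by rewrite /path_weight /=; ring.
rewrite ![path_weight (_ :: _ :: _)]path_weight_cons // !intrM.
by rewrite mulr1z mulrN1z; field.
Qed.

Lemma probability_split s B : all is_step s -> measurable B ->
  (P (B `&` path_event s)
   = P (B `&` path_event (1%R :: s)) + P (B `&` path_event ((-1)%R :: s)))%E.
Proof.
move=> s_steps mB.
pose F (i : 'I_2) := X (size s).+1 @^-1` [set if i == ord0 then 1 else -1].
have PA : P (path_event s) = (\sum_(i < 2) P (path_event s `&` F i))%E.
  rewrite big_ord_recl big_ord1 /F /= ![path_event s `&` _]setIC.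
  rewrite -!/(path_event (_ :: s)) !(probability_path erw) //=.
  by rewrite -EFinD path_weight_split.
have mBs : measurable (B `&` path_event s).
  by apply: measurableI => //; exact: measurable_path_event.
rewrite (probability_partition (measurable_path_event X s) mBs _ _ _ PA) //.
- rewrite big_ord_recl big_ord1 /F /= -!setIA.
  by rewrite ![path_event s `&` _]setIC.
- by move=> i; exact: measurable_RV_preimage.
- apply/trivIsetP => i j _ _ ij; rewrite -subset0 => w [/= Xi Xj]; move: ij.
  have := etrans (esym Xi) Xj; rewrite -(inj_eq val_inj) /= -!(inj_eq val_inj) /=.
  by case: i {Xi} => [[|[|//]]] ?; case: j {Xj} => [[|[|//]]] ?.
Qed.

Definition avoids m k : set T :=
  [set w | forall i, (m <= i <= m + k)%N -> position X i w <> 0].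

Lemma measurable_avoids m k : measurable (avoids m k).
Proof.
rewrite [X in measurable X](_ : _ =
  \bigcap_(i in [set i | (m <= i <= m + k)%N]) (position X i @^-1` ~` [set 0])).
  apply: bigcap_measurableType => i _; exact: measurable_position_preimage.
by rewrite eqEsubset; split=> w /= h i; exact: h.
Qed.

Lemma probability_avoids s k : s != [::] -> all is_step s ->
  P (avoids (size s) k `&` path_event s)
  = (path_weight s * survival c0 k (size s) (endpoint s))%:E.
Proof.
elim: k s => [|k IH] s s_neq s_steps.
  rewrite /=; case: eqVneq => s0.
    rewrite mulr0 (_ : _ `&` _ = set0) ?measure0 // -subset0 => w [/= h sw].
    by apply: (h (size s)); rewrite ?addn0 ?leqnn // position_path.
  rewrite mulr1 -(probability_path erw) //; congr (P _).
  rewrite eqEsubset; split=> w; first by case.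
  move=> sw; split=> // i; rewrite addn0 -eqn_leq => /eqP <-.
  by rewrite position_path //; exact/eqP.
rewrite /=; case: eqVneq => s0.
  rewrite mulr0 (_ : _ `&` _ = set0) ?measure0 // -subset0 => w [/= h sw].
  by apply: (h (size s)); rewrite ?leqnn ?leq_addr // position_path.
have avoids_cons e : avoids (size s) k.+1 `&` path_event (e :: s)
    = avoids (size s).+1 k `&` path_event (e :: s).
  rewrite eqEsubset; split=> w [h sw]; split=> // i i_range.
    by apply: h; lia.
  have [i_eq|i_neq] := eqVneq i (size s); last by apply: h; lia.
  by rewrite i_eq position_path; [exact/eqP|exact: sw.2].
rewrite (probability_split s_steps (measurable_avoids _ _)) !avoids_cons.
have := IH (1 :: s) isT s_steps; have := IH (-1 :: s) isT s_steps => /= -> ->.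
rewrite -EFinD !path_weight_cons // !big_cons; congr (_%:E).
rewrite [1 + endpoint s]addrC [-1 + endpoint s]addrC mul1r mulN1r rmorphN /=.
by ring.
Qed.

End path_survival.

(** * Expansion over paths of probabilities and expectations *)

Fixpoint step_paths (m : nat) : seq (seq int) :=
  if m is m'.+1 then
    [seq 1 :: s | s <- step_paths m'] ++ [seq -1 :: s | s <- step_paths m']
  else [:: [::]].

Lemma step_paths_uniq m : uniq (step_paths m).
Proof.
elim: m => //= m IH; rewrite cat_uniq !map_inj_uniq; try by move=> s s' [].
rewrite IH andbT /=; apply/hasPn => _ /mapP[s _ ->]; apply/negP.
by move=> /mapP[s' _ []].
Qed.

Lemma step_pathsP m s : s \in step_paths m -> size s = m /\ all is_step s.
Proof.
elim: m s => [|m IH] s; first by rewrite inE => /eqP ->.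
by rewrite /= mem_cat => /orP[] /mapP[s' /IH[<- s'_steps] ->].
Qed.

Lemma endpoint_bound s : all is_step s ->
  (absz (\sum_(e <- s) e)%R <= size s)%N /\
  ~~ odd (size s + absz (\sum_(e <- s) e)%R).
Proof.
elim: s => [|e s IH]; first by rewrite big_nil.
rewrite /= big_cons => /andP[e_step /IH []]; move: (\sum_(i <- s) i) => y.
by case/orP: e_step => /eqP ->; lia.
Qed.

Section path_expansion.
Local Set Implicit Arguments.
Local Unset Strict Implicit.
Context d (T : measurableType d) (R : realType) (P : probability T R).
Context (p q : R) (X : nat -> {RV P >-> int}) (U : nat -> {RV P >-> nat}).
Context (eps : nat -> {RV P >-> int}).
Hypothesis erw : elephant_random_walk P p q X U eps.
Implicit Types (s : seq int).

Local Notation c0 := (elephant_drift (2 * p - 1)).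
Local Notation path_event := (path_event X).
Local Notation path_weight := (path_weight p q).
Local Notation endpoint s := (\sum_(e <- s) e).

(** The increments may differ from +-1 on a null set, so the paths of +-1 steps
carry the whole mass without covering the space. *)
Lemma total_probability_paths m B : measurable B ->
  (P B = \sum_(s <- step_paths m) P (B `&` path_event s))%E.
Proof.
move=> mB; elim: m => [|m ->]; first by rewrite big_seq1 setIT.
transitivity (\sum_(s <- step_paths m) (P (B `&` path_event (1%R :: s))
    + P (B `&` path_event ((-1)%R :: s))))%E.
  rewrite big_seq [RHS]big_seq; apply: eq_bigr => s /step_pathsP[_ s_steps].
  exact: (probability_split erw).
by rewrite big_split /= big_cat !big_map.
Qed.

(** Events that can be read off from the trajectory up to time m.  The members of
the sigma-algebra of S_0, ..., S_m are of this kind, and such an event contains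
or excludes each path of length m as a whole. *)
Definition position_determined m (A : set T) := forall w w',
  (forall i, (i <= m)%N -> position X i w = position X i w') -> A w -> A w'.

Lemma position_sigma_algebra_determined m A :
  position_sigma_algebra X m A -> position_determined m A.
Proof.
move: A; apply: smallest_sub.
  split.
  - by move=> w w' _.
  - move=> A A_det w w' ww' [_ nAw]; split=> // Aw'; apply: nAw.
    by apply: A_det Aw' => i /ww'.
  - by move=> F F_det w w' ww' [n _ Fw]; exists n => //; exact: F_det Fw.
move=> A [i /= i_le [B _ <-]] w w' ww'; rewrite setTI /= => Bw.
by rewrite -ww' // -ltnS.
Qed.

Lemma position_sigma_algebra_measurable m A :
  position_sigma_algebra X m A -> measurable A.
Proof.
move: A; apply: smallest_sub; first exact: sigma_algebra_measurable.
by move=> A [i _ [B _ <-]]; rewrite setTI; exact: (measurable_position_preimage).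
Qed.

Lemma T0_gtP n w : T0_gt X n w <->
  forall i, (1 <= i <= n)%N -> position X i w <> 0.
Proof.
rewrite /T0_gt /T0 /=; split=> [lt_T0 i /andP[i_ge1 i_le] Si|h].
  move: lt_T0; apply/negP; rewrite -leNgt; apply: ge_ereal_inf.
  by exists i%:R%:E; [exists i|rewrite lee_fin ler_nat].
apply: (@lt_le_trans _ _ n.+1%:R%:E); first by rewrite lte_fin ltr_nat.
apply: le_ereal_inf_tmp => _ [i [i_ge1 Si] <-]; rewrite lee_fin ler_nat.
by rewrite ltnNge; apply/negP => i_le; apply: (h i); rewrite ?i_ge1.
Qed.

Lemma T0_gt_determined n : position_determined n (T0_gt X n).
Proof.
move=> w w' ww' /T0_gtP h; apply/T0_gtP => i i_range.
by rewrite -ww'; [exact: h|case/andP: i_range].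
Qed.

Lemma T0_gt_avoids m k : (0 < m)%N ->
  T0_gt X (m + k) = T0_gt X m `&` avoids X m k.
Proof.
move=> m_gt0; rewrite eqEsubset; split=> w.
  by move=> /T0_gtP h; split; [apply/T0_gtP|] => i i_range; apply: h; lia.
move=> [/T0_gtP h h']; apply/T0_gtP => i i_range.
by have [i_le|i_gt] := leqP i m; [apply: h|apply: h']; lia.
Qed.

Lemma measurable_T0_gt n : measurable (T0_gt X n).
Proof.
rewrite [X in measurable X](_ : _ =
  \bigcap_(i in [set i | (1 <= i <= n)%N]) (position X i @^-1` ~` [set 0])).
  by apply: bigcap_measurableType => i _; exact: measurable_position_preimage.
rewrite eqEsubset; split=> w; first by move=> /T0_gtP h i; exact: h.
by move=> h; apply/T0_gtP => i; exact: h.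
Qed.

Definition path_indicator (A : set T) s : R := (`[< path_event s `<=` A >])%:R.

Lemma path_event_determined A s : position_determined (size s) A ->
  A `&` path_event s = if `[< path_event s `<=` A >] then path_event s else set0.
Proof.
move=> A_det; case: asboolP => [sA|nsA].
  by rewrite setIC; apply/setIidPl.
rewrite -subset0 => w [Aw sw]; apply: nsA => w' sw'.
apply: A_det Aw => i i_le; exact: position_path_eq sw sw' i_le.
Qed.

Lemma probability_T0_gt m k A : (0 < m)%N -> measurable A ->
  position_determined m A ->
  P (A `&` T0_gt X (m + k)) = (\sum_(s <- step_paths m)
    path_indicator (A `&` T0_gt X m) s * path_weight s
    * survival c0 k m (endpoint s))%:E.
Proof.
move=> m_gt0 mA A_det; rewrite (total_probability_paths m); last first.
  by apply: measurableI => //; exact: measurable_T0_gt.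
rewrite -sumEFin big_seq [RHS]big_seq; apply: eq_bigr => s /step_pathsP[s_size s_steps].
rewrite T0_gt_avoids // (setIA A) [_ `&` path_event s]setIAC.
rewrite path_event_determined; last first.
  rewrite s_size => w w' ww' [Aw Tw]; split; first exact: (A_det w w' ww' Aw).
  exact: T0_gt_determined Tw.
rewrite /path_indicator; case: asboolP => _; last by rewrite set0I measure0 !mul0r.
rewrite setIC mul1r -s_size (probability_avoids erw) //.
by rewrite -size_eq0 s_size -lt0n.
Qed.

Lemma probability_T0_gt1 k :
  P (T0_gt X (1 + k)) = (survival c0 k 1 1)%:E.
Proof.
have := @probability_T0_gt 1 k setT isT measurableT ltac:(by []).
rewrite !setTI => ->; congr (_%:E).
have ind e : is_step e -> path_indicator (T0_gt X 1) [:: e] = 1.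
  move=> e_step; rewrite /path_indicator; case: asboolP => // -[] w sw.
  apply/T0_gtP => -[|[|//]] // _.
  by rewrite (position_path sw) big_seq1; case/orP: e_step => /eqP ->.
rewrite /= !big_cons !big_nil !addr0 !ind // survivalN.
by rewrite /path_weight /=; ring.
Qed.

(** Almost surely the trajectory is one of the +-1 paths, and on each of them the
integrand is constant. *)
Lemma expectation_paths m A (g : int -> R) : (forall y, 0 <= g y) ->
  measurable A -> position_determined m A ->
  'E_P[(fun w => \1_A w * g (position X m w) * \1_(T0_gt X m) w)%R]%E
  = (\sum_(s <- step_paths m)
      path_indicator (A `&` T0_gt X m) s * path_weight s * g (endpoint s))%:E.
Proof.
move=> g_ge0 mA A_det; have mT0 := measurable_T0_gt m.
set A' := A `&` T0_gt X m.
have A'_det : position_determined m A'.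
  move=> w w' ww' [Aw Tw]; split; first exact: (A_det w w' ww' Aw).
  exact: T0_gt_determined Tw.
pose c s := path_indicator A' s * g (endpoint s).
have c_ge0 s : 0 <= c s by rewrite mulr_ge0 ?ler0n.
have mE s := measurable_path_event X s.
rewrite unlock.
transitivity (\int[P]_w (\sum_(s <- step_paths m)
    ((c s)%:E * (\1_(path_event s) w)%:E)))%E; last first.
  rewrite ge0_integral_sum //.
  - rewrite -sumEFin big_seq [RHS]big_seq; apply: eq_bigr => s /step_pathsP[_ s_steps].
    rewrite ge0_integralZl_EFin //.
      rewrite integral_indic // setIT.
      transitivity ((c s)%:E * P (path_event s))%E => //.
      rewrite (probability_path erw) // -EFinM.
      by congr (_%:E); rewrite /c; ring.
    by apply/measurable_EFinP; exact: measurable_indic.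
  - move=> s; apply/measurable_EFinP; apply: measurable_funM => //.
  - by move=> s w _; rewrite -EFinM lee_fin mulr_ge0.
have mg : measurable_fun setT (g \o position X m).
  by move=> _ B mB; rewrite setTI; exact: (measurable_position_preimage X m (g @^-1` B)).
apply: ge0_ae_eq_integral => //.
- apply/measurable_EFinP; apply: measurable_funM => //.
  by apply: measurable_funM => //; exact: measurable_indic.
- apply: emeasurable_sum => s; apply/measurable_EFinP.
  by apply: measurable_funM => //; exact: measurable_indic.
- by move=> w _; rewrite lee_fin !mulr_ge0.
- by move=> w _; apply: sume_ge0 => s _; rewrite -EFinM lee_fin mulr_ge0.
(* Outside of the null set where the trajectory is not a +-1 path, exactly one
   term of the sum is nonzero. *)
pose C := \big[setU/set0]_(s <- step_paths m) path_event s.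
have mC : measurable C by exact: bigsetU_measurable.
have PC : P (~` C) = 0%E.
  rewrite (total_probability_paths m); last exact: measurableC.
  rewrite big_seq big1 // => s s_path; rewrite [X in P X](_ : _ = set0) ?measure0 //.
  rewrite -subset0 => w [nCw sw]; apply: nCw.
  by rewrite /C -bigcup_seq; exists s.
exists (~` C); split; [exact: measurableC|exact: PC|].
apply: subsetC => w; rewrite /C -bigcup_seq => -[s s_path sw] _.
have [s_size s_steps] := step_pathsP _ _ s_path.
rewrite (bigD1_seq s) //=; last exact: step_paths_uniq.
rewrite big_seq_cond big1 => [|s' /andP[s'_path s's]]; last first.
  rewrite indicE memNset ?mule0 // => s'w; case/eqP: s's.
  have [s'_size _] := step_pathsP _ _ s'_path.
  apply: (@eq_from_nth _ 0) => [|i i_lt]; first by rewrite s_size.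
  rewrite -(path_event_nth s'w) //.
  by rewrite -(path_event_nth sw) ?s_size -?s'_size.
rewrite adde0 !indicE (mem_set sw) mule1; congr (_%:E).
rewrite -s_size (position_path sw) s_size mulrAC -!indicE; congr (_ * _).
have := @path_event_determined A' s; rewrite s_size => /(_ A'_det).
rewrite /path_indicator; case: asboolP => _ A's.
  have [[Aw Tw] _] : (A' `&` path_event s) w by rewrite A's.
  by rewrite !indicE !mem_set // mulr1.
have nA'w : ~ A' w by move=> A'w; have : (A' `&` path_event s) w by []; rewrite A's.
rewrite !indicE; have [Aw|nAw] := pselect (A w); last by rewrite memNset // mul0r.
by rewrite [w \in T0_gt X m]memNset ?mulr0 // => Tw; apply: nA'w.
Qed.

End path_expansion.

(** * Harmonicity of h and the conditional limit *)

Section harmonic.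
Local Set Implicit Arguments.
Local Unset Strict Implicit.
Context (R : realType) (p : R).
Hypothesis p_gt0 : 0 < p.

Local Notation c0 := (elephant_drift (2 * p - 1)).

Lemma a_gt0 n : (0 < n)%N -> 0 < a p n.
Proof.
rewrite -(ler1n R) => n_ge1.
by rewrite /a divr_gt0 // Gamma_gt0 //; move: p_gt0; lra.
Qed.

Lemma aS n : (0 < n)%N -> a p n.+1 = a p n / (1 + c0 n).
Proof.
rewrite -(ler1n R) => n_ge1; rewrite /a -natr1 GammaS; last lra.
have n_gt0 : 0 < n%:R + 2 * p - 1 by move: p_gt0; lra.
have -> : n%:R + 1 + 2 * p - 1 = (n%:R + 2 * p - 1) + 1 by ring.
rewrite GammaS // /elephant_drift; have := Gamma_gt0 n_gt0.
move: (Gamma _) (Gamma _) => x y y_gt0; field.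
by rewrite !gt_eqF //=; [lra|move: n_gt0; lra].
Qed.

(** The constant of [survival_ratio_cvg] in terms of Gamma. *)
Lemma h_ratio m y : (0 < m)%N ->
  h p m y / h p 0 0 = `|y|%:~R / \prod_(1 <= i < m) (1 + c0 i).
Proof.
move=> m_gt0; rewrite /h eqn0Ngt m_gt0 /=.
have a1 := a_gt0 (ltn0Sn 0).
have -> : a p m = a p 1 / \prod_(1 <= i < m) (1 + c0 i).
  elim: m m_gt0 => // -[|m] IH _; first by rewrite big_geq // divr1.
  by rewrite aS // IH // [in RHS]big_nat_recr //= invfM mulrA.
by set r := (\prod_(_ <= _ < _) _)^-1; field; rewrite gt_eqF.
Qed.

(** The weighted mean of |y + 1| and |y - 1| is |y| (1 + al / m), and the factor
turns a_(m+1) into a_m. *)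
Lemma one_step_h q m (y : int) :
  (m = 0%N /\ y = 0) \/ ((1 <= m)%N /\ y <> 0) ->
  one_step_expectation p q m y (fun z => h p m.+1 z * (z != 0)%:R) = h p m y.
Proof.
case=> [[-> ->]|[m_gt0 y_neq0]].
  by rewrite /one_step_expectation /h /= normrN1 normr1 !mulr1; ring.
have hE z : h p m.+1 z * (z != 0)%:R = a p m.+1 * `|z|%:~R.
  by rewrite /h /=; case: eqVneq => [->|_]; rewrite ?normr0 ?mulr0 ?mulr1 ?mul0r.
rewrite /one_step_expectation eqn0Ngt m_gt0 /= !hE /h eqn0Ngt m_gt0 /= aS //.
have m_ge1 : 1 <= m%:R :> R by rewrite ler1n.
have c_gt0 : 0 < m%:R + (2 * p - 1) by move: p_gt0; lra.
rewrite /elephant_drift.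
have [y_lt0|y_gt0|//] := ltgtP y 0.
  have -> : `|y + 1| = - y - 1 by lia.
  have -> : `|y - 1| = - y + 1 by lia.
  have -> : `|y| = - y by lia.
  rewrite intrB intrD rmorphN /=; field.
  by rewrite !gt_eqF //; lra.
have -> : `|y + 1| = y + 1 by lia.
have -> : `|y - 1| = y - 1 by lia.
have -> : `|y| = y by lia.
rewrite intrB intrD /=; field.
by rewrite !gt_eqF //; lra.
Qed.

End harmonic.

Section conditioning.
Local Set Implicit Arguments.
Local Unset Strict Implicit.
Context d (T : measurableType d) (R : realType) (P : probability T R).
Context (p q : R) (X : nat -> {RV P >-> int}) (U : nat -> {RV P >-> nat}).
Context (eps : nat -> {RV P >-> int}).
Hypotheses (p_gt0 : 0 < p) (p_le : p <= 3 / 4).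
Hypothesis erw : elephant_random_walk P p q X U eps.

Local Notation c0 := (elephant_drift (2 * p - 1)).

Let al_gtN1 : -1 < 2 * p - 1. Proof. by move: p_gt0; lra. Qed.
Let al_le : 2 * p - 1 <= 2^-1. Proof. by move: p_le; lra. Qed.

Lemma cond_prob_survival m k A : (0 < m)%N -> position_sigma_algebra X m A ->
  cond_prob P A (T0_gt X (m + k)) = \sum_(s <- step_paths m)
    path_indicator X (A `&` T0_gt X m) s * path_weight p q s
    * (survival c0 k m (absz (\sum_(e <- s) e)%R)%:Z / survival c0 (m.-1 + k) 1 1).
Proof.
move=> m_gt0 sA; have mA := position_sigma_algebra_measurable sA.
have A_det := position_sigma_algebra_determined sA.
rewrite /cond_prob (probability_T0_gt erw) //.
have -> : (m + k = 1 + (m.-1 + k))%N by lia.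
rewrite (probability_T0_gt1 erw) /= mulr_suml; apply: eq_bigr => s _.
rewrite [RHS]mulrA; congr (_ * _ / _).
have [y_ge0|y_lt0] := leP 0 (\sum_(e <- s) e); first by rewrite gez0_abs.
by rewrite ltz0_abs // survivalN.
Qed.

Lemma cond_prob_cvg m A : (0 < m)%N -> position_sigma_algebra X m A ->
  (cond_prob P A (T0_gt X N))%:E @[N --> \oo] -->
  'E_P[(fun w => \1_A w * (h p m (position X m w) / h p 0 0)
                * \1_(T0_gt X m) w)%R]%E.
Proof.
move=> m_gt0 sA; have mA := position_sigma_algebra_measurable sA.
have A_det := position_sigma_algebra_determined sA.
rewrite (expectation_paths erw (g := fun y => h p m y / h p 0 0)) //; last first.
  move=> y; rewrite h_ratio //; apply: divr_ge0; first by rewrite ler0z.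
  rewrite big_seq; apply: prodr_ge0 => i; rewrite mem_index_iota => /andP[i_gt0 _].
  exact/ltW/one_plus_elephant_drift_gt0.
set L := (\sum_(s <- _) _).
suff h : cond_prob P A (T0_gt X N) @[N --> \oo] --> L.
  by apply: cvg_EFin; [exact: nearW|exact: h].
rewrite -(cvg_shiftn m) {}/L.
pose w s : R := path_indicator X (A `&` T0_gt X m) s * path_weight p q s.
rewrite (_ : [sequence cond_prob P A (T0_gt X (N + m))]_N = fun k =>
  \sum_(s <- step_paths m | s \in step_paths m) w s
    * (survival c0 k m (absz (\sum_(e <- s) e)%R)%:Z
       / survival c0 (m.-1 + k) 1 1)); last first.
  by apply/funext => k /=; rewrite addnC cond_prob_survival // big_seq.
rewrite (_ : \sum_(s <- _) _ = \sum_(s <- step_paths m | s \in step_paths m)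
  w s * (h p m (\sum_(e <- s) e) / h p 0 0)); last by rewrite big_seq.
apply: cvg_big => [|s /step_pathsP[s_size s_steps]]; first exact: add_continuous.
apply: cvgMl_tmp; rewrite h_ratio //.
have [y_le y_even] := endpoint_bound _ s_steps; rewrite s_size in y_le y_even.
have := survival_ratio_cvg al_gtN1 al_le m_gt0 y_le y_even.
by rewrite -abszE.
Qed.

(** Time 0 is separate because the path expansion needs a nonempty path: S_0 = 0
carries no information. *)
Lemma position_sigma_algebra0 A : position_sigma_algebra X 0 A ->
  A = set0 \/ A = setT.
Proof.
move=> /position_sigma_algebra_determined A_det.
have [->|/set0P[w Aw]] := eqVneq A set0; [by left|right].
rewrite -subTset => w' _; apply: A_det Aw => i; rewrite leqn0 => /eqP ->.
by rewrite !position0.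
Qed.

Lemma cond_prob_cvg0 A : position_sigma_algebra X 0 A ->
  (cond_prob P A (T0_gt X N))%:E @[N --> \oo] -->
  'E_P[(fun w => \1_A w * (h p 0 (position X 0 w) / h p 0 0)
                * \1_(T0_gt X 0) w)%R]%E.
Proof.
move=> sA; have mA := position_sigma_algebra_measurable sA.
have -> : (fun w => \1_A w * (h p 0 (position X 0 w) / h p 0 0)
                * \1_(T0_gt X 0) w)%R = (\1_A : T -> R).
  apply/funext => w; rewrite /h /= divff ?gt_eqF ?a_gt0 // mulr1.
  rewrite [X in _ * X]indicE mem_set ?mulr1 //.
  by apply/T0_gtP => i; case: i.
rewrite expectation_indic // -(cvg_shiftn 1).
rewrite (_ : [sequence (cond_prob P A (T0_gt X (N + 1)))%:E]_N = fun=> P A).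
  exact: cvg_cst.
apply/funext => k /=; rewrite addnC /cond_prob.
have [->|->] := position_sigma_algebra0 sA.
  by rewrite set0I measure0 mul0r.
rewrite setTI (probability_T0_gt1 erw) /= divff ?probability_setT //.
by rewrite gt_eqF // survival_elephant_gt0.
Qed.

End conditioning.

Theorem theorem1p3 (d : measure_display) (T : measurableType d)
    (R : realType) (P : probability T R) (p q : R)
    (X : nat -> {RV P >-> int}) (U : nat -> {RV P >-> nat})
    (eps : nat -> {RV P >-> int})
    (p_gt0 : 0 < p) (p_le : p <= 3 / 4) (q_gt0 : 0 < q) (q_lt1 : q < 1)
    (erw : elephant_random_walk P p q X U eps) :
  (forall (m : nat) (A : set T), position_sigma_algebra X m A ->
     (cond_prob P A (T0_gt X N))%:E @[N --> \oo] -->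
     'E_P[(fun w => \1_A w * (h p m (position X m w) / h p 0 0)
                   * \1_(T0_gt X m) w)%R]%E) /\
  (forall (m : nat) (y : int),
     (m = 0%N /\ y = 0) \/ ((1 <= m)%N /\ y <> 0) ->
     one_step_expectation p q m y (fun z => h p m.+1 z * (z != 0)%:R)
     = h p m y).
Proof.
split=> [m A sA|m y my]; last exact: one_step_h.
case: m sA => [|m] sA; first exact: (cond_prob_cvg0 p_gt0 p_le erw).
exact: (cond_prob_cvg p_gt0 p_le erw).
Qed.
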